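(* Let $\mathcal{S}=\bigcup_j\mathcal{S}_j$ be a countable union of disjoint $(\varepsilon_j,d_j)$-configurations $\mathcal{S}_j$ in $\mathbb{T}^\omega$, with $\varepsilon_j\in(0,\frac12]$ and $d_j\in\mathbb{N}$, and let $A_p(\mathcal{S}):=\sup_j\varepsilon_j d_j^{1/p}$. Then for each $p\in(1,\infty)$, $$\|\mathcal{M}_{\mathcal{S}}\|_{L^p\to L^{p,\infty}}<\infty\iff A_p(\mathcal{S})<\infty .$$ In particular, let $p_0\in(1,\infty)$ and let $j$ range over $\mathbb{N}$. If $\varepsilon_j=\frac1{j+1}$ and $d_j=\lfloor j^{p_0}\rfloor$ for all $j$, then the set of $p\in[1,\infty]$ for which $\mathcal{M}_{\mathcal{S}}$ is bounded from $L^p$ to $L^{p,\infty}$ is exactly $[p_0,\infty]$. If $\varepsilon_j=\frac1{j+1}$ and $d_j=\lfloor\log(j+2)\,j^{p_0}\rfloor$ for all $j$, then this set is exactly $(p_0,\infty]$.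
   Context: $\mathbb{N}=\{1,2,\dots\}$; $\log$ is the natural logarithm. $\mathbb{T}^\omega$ is the product of countably many copies of $\mathbb{T}=\mathbb{R}/\mathbb{Z}$ (identified with $[0,1)$), with normalized Haar measure $dx$; $|E|$ denotes the measure of $E$. $L^p = L^p(\mathbb{T}^\omega)$. Sets $V_m$ and subgroups $H_m$, $m\in\mathbb{N}$. To each $m$ assign a finite list of positive integers (exponents) $(a_1,\dots,a_N)$ as follows. If $m=1$ the list is $(1)$. If $m=n^2+j$ with $n\ge 1$ and $1\le j\le n$, then $N=n+1$, $a_1=\dots=a_n=n$, $a_{n+1}=j$. If $m=n^2+n+j$ with $n\ge1$ and $1\le j\le n+1$, then $N=n+1$, $a_i=n+1$ for $i\le j$ and $a_i=n$ for $j<i\le n+1$. Put $V_m=\prod_{i=1}^N(0,2^{-a_i})\times\mathbb{T}\times\mathbb{T}\times\cdots$ and $H_m=\prod_{i=1}^N\{0,2^{-a_i},\dots,(2^{a_i}-1)2^{-a_i}\}\times\{0\}\times\{0\}\times\cdots$. The first $N$ coordinates are called the nonfree coordinates of $V_m$. (For example $V_2=(0,\frac12)^2\times\mathbb{T}\times\cdots$, $V_3=(0,\frac14)\times(0,\frac12)\times\mathbb{T}\times\cdots$, $V_4=(0,\frac14)^2\times\mathbb{T}\times\cdots$, $V_5=(0,\frac14)^2\times(0,\frac12)\times\mathbb{T}\times\cdots$.) Let $\mathcal{R}_0=\{t+V_m: m\in\mathbb{N},\ t\in H_m\}$. $(\varepsilon,d)$-configuration. Let $\varepsilon\in(0,\frac12]$,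 $d\in\mathbb{N}$, and let $Q=t+V_m\in\mathcal{R}_0$ ($t\in H_m$) with $m$ so large that $V_m$ has at least $d$ nonfree coordinates. For $k\in\{1,\dots,d\}$ let $Q_k=T_k+Q$, where $T_k\in\mathbb{T}^\omega$ has $k$-th coordinate $(1-\varepsilon)|\pi_k(Q)|$ and all other coordinates $0$; here $\pi_k$ is the projection onto the $k$-th coordinate and $|\pi_k(Q)|$ is the length of $\pi_k(Q)\subset\mathbb{T}$. Then $\{Q_1,\dots,Q_d\}$ is called an $(\varepsilon,d)$-configuration around $Q$; an $(\varepsilon,d)$-configuration is an $(\varepsilon,d)$-configuration around some such $Q$. (The set $Q$ itself is not a member of the configuration.) Configurations $\mathcal{S}_j$ are called disjoint if the sets $\operatorname{sh}(\mathcal{S}_j):=\bigcup_{E\in\mathcal{S}_j}E$ are pairwise disjoint. Maximal operator. For a collection $\mathcal{B}$ of measurable sets of positive measure, $\mathcal{M}_{\mathcal{B}}f(x)=\sup_{B\in\mathcal{B},\,x\in B}\frac1{|B|}\int_B|f|\,dx$, with $\mathcal{M}_{\mathcal{B}}f(x)=0$ if no $B\in\mathcal{B}$ contains $x$. For $p\in[1,\infty)$, $\|\mathcal{M}_{\mathcal{B}}\|_{L^p\to L^{p,\infty}}$ is the smallest $K\in[0,\infty]$ such that $\lambda\,|\{\mathcal{M}_{\mathcal{B}}f>\lambda\}|^{1/p}\le K\|f\|_{L^p}$ for all $f\in L^p$ and $\lambda>0$; for $p=\infty$, $L^{\infty,\infty}=L^\infty$. Bounded means that this norm is finite. *)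

(* Defs.v *)
From HB Require Import structures.
From mathcomp Require Import all_boot all_order all_algebra.
From mathcomp Require Import all_classical all_reals all_analysis.
From mathcomp Require Import zify.

Set Implicit Arguments.
Unset Strict Implicit.
Unset Printing Implicit Defensive.

Import Order.TTheory GRing.Theory Num.Theory.
Import numFieldNormedType.Exports.

Local Open Scope classical_set_scope.
Local Open Scope ring_scope.

(* R/Z, identified with [0, 1[; [circ] is the quotient map R -> R/Z. *)
Record circle (R : realType) : Type :=
  Circle { circle_val : R; _ : 0 <= circle_val < 1 }.

Section circle.
Variable R : realType.

HB.instance Definition _ := [isSub for @circle_val R].
HB.instance Definition _ := [Choice of circle R by <:].

Lemma frac_subproof (x : R) : 0 <= x - (Num.floor x)%:~R < 1.
Proof.
have /andP[h1 h2] := real_floor_itv (num_real x).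
by rewrite subr_ge0 h1 /= ltrBlDl -[X in _ + X]/(1%:~R) -intrD.
Qed.

Definition circ (x : R) : circle R := Circle (frac_subproof x).

Lemma circDz (x : R) (n : int) : circ (x + n%:~R) = circ x.
Proof.
apply: val_inj => /=; rewrite floorDrz ?intr_int// intrKfloor intrD.
by rewrite opprD addrACA subrr addr0.
Qed.

Lemma circK (x : circle R) : circ (circle_val x) = x.
Proof.
apply: val_inj => /=; have /andP[h1 h2] := valP x.
have /eqP -> : Num.floor (circle_val x) == 0 by rewrite floor_eq mulr0z add0r h1.
by rewrite mulr0z subr0.
Qed.

Definition circle_add (x y : circle R) : circle R := circ (circle_val x + circle_val y).
Definition circle_opp (x : circle R) : circle R := circ (- circle_val x).

Lemma circle_addE (x y : R) : circle_add (circ x) (circ y) = circ (x + y).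
Proof. by rewrite /circle_add /= addrACA -opprD -intrD -mulrNz circDz. Qed.

Lemma circle_addA : associative circle_add.
Proof.
move=> x y z; rewrite -[x]circK -[y]circK -[z]circK.
by rewrite !circle_addE addrA.
Qed.

Lemma circle_addC : commutative circle_add.
Proof. by move=> x y; rewrite /circle_add addrC. Qed.

Lemma circle_add0 : left_id (circ 0) circle_add.
Proof. by move=> x; rewrite -[x]circK circle_addE add0r. Qed.

Lemma circle_addN : left_inverse (circ 0) circle_opp circle_add.
Proof.
move=> x; have {2}<- := circK x.
by rewrite circle_addE addNr.
Qed.

HB.instance Definition _ := GRing.isZmodule.Build (circle R)
  circle_addA circle_addC circle_add0 circle_addN.
HB.instance Definition _ := isPointed.Build (circle R) 0.

End circle.

(* Coordinates are numbered from 0: the k-th coordinate, k >= 1, is the one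
   of index k - 1. *)
Definition torus (R : realType) : Type := nat -> circle R.

(* The product (equivalently, Borel) sigma-algebra on the torus. *)
Definition torus_cylinders (R : realType) : set (set (nat -> circle R)) :=
  [set C | exists (i : nat) (B : set R),
    measurable B /\ C = [set x | B (circle_val (x i))]].

Section torus_instances.
Variable R : realType.
HB.instance Definition _ := GRing.Zmodule.copy (torus R) (nat -> circle R).
HB.instance Definition _ :=
  Measurable.copy (torus R) (g_sigma_algebraType (@torus_cylinders R)).
End torus_instances.

(* Among probability measures on the Borel sets of the compact metrizable group
   torus R, translation invariance characterizes the normalized Haar measure. *)
Definition is_haar (R : realType) (mu : probability (torus R) R) : Prop :=
  forall (t : torus R) (A : set (torus R)), measurable A ->
    mu [set t + x | x in A] = mu A.

(* For m >= 2, [n] is the integer such that n ^ 2 < m <= (n + 1) ^ 2, and both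
   cases m = n ^ 2 + j and m = n ^ 2 + n + j are read off m - n ^ 2; for m = 1,
   n = 0 and the second branch gives the list (1).  See the lemmas below. *)
Definition exponents (m : nat) : seq nat :=
  let n := (\max_(k < m | (k ^ 2 < m)%N) k)%N in
  let j := (m - n ^ 2)%N in
  if (j <= n)%N then rcons (nseq n n) j
  else nseq (j - n) n.+1 ++ nseq (n.+1 - (j - n)) n.

Lemma bigmax_sqr (m n : nat) : (n ^ 2 < m <= n.+1 ^ 2)%N ->
  (\max_(k < m | (k ^ 2 < m)%N) k)%N = n.
Proof.
move=> /andP[nm mn]; apply/eqP; rewrite eqn_leq; apply/andP; split.
  apply/bigmax_leqP => i im; rewrite leqNgt; apply/negP => ni.
  by have := leq_trans im mn; rewrite ltnNge leq_exp2r // ni.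
have lt_nm : (n < m)%N by case: n nm {mn} => [|n] nm; nia.
exact: (@leq_bigmax_cond _ (fun k : 'I_m => (k ^ 2 < m)%N) (fun k => k : nat)
  (Ordinal lt_nm)).
Qed.

Lemma exponents1 : exponents 1 = [:: 1%N].
Proof. by rewrite /exponents (@bigmax_sqr 1 0). Qed.

Lemma exponents_lo (n j : nat) : (1 <= n)%N -> (1 <= j <= n)%N ->
  exponents (n ^ 2 + j) = rcons (nseq n n) j.
Proof.
move=> n1 /andP[j1 jn]; rewrite /exponents (@bigmax_sqr _ n).
  by rewrite addKn jn.
by apply/andP; split; nia.
Qed.

Lemma exponents_hi (n j : nat) : (1 <= n)%N -> (1 <= j <= n.+1)%N ->
  exponents (n ^ 2 + n + j) = nseq j n.+1 ++ nseq (n.+1 - j) n.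
Proof.
move=> n1 /andP[j1 jn]; rewrite /exponents (@bigmax_sqr _ n).
  by rewrite -addnA addKn addKn leqNgt -addn1 leq_add2l j1.
by apply/andP; split; nia.
Qed.

Section configurations.
Variable R : realType.
Implicit Types (t : torus R) (Q : set (torus R)).

Definition Vset (m : nat) : set (torus R) :=
  [set x | forall i, (i < size (exponents m))%N ->
    0 < circle_val (x i) < 2 ^- nth 0%N (exponents m) i].

Definition Hset (m : nat) : set (torus R) :=
  [set t |
    (forall i, (i < size (exponents m))%N ->
      exists2 c : nat, (c < 2 ^ nth 0%N (exponents m) i)%N &
        t i = circ (c%:R * 2 ^- nth 0%N (exponents m) i)) /\
    (forall i, (size (exponents m) <= i)%N -> t i = 0)].

Definition translate t Q : set (torus R) := [set t + x | x in Q].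

(* |pi_i(Q)| *)
Definition proj_length Q (i : nat) : R :=
  fine (lebesgue_measure [set circle_val (x i) | x in Q]).

Definition config_shift (eps : R) Q (k : nat) : torus R :=
  fun i => if i == k then circ ((1 - eps) * proj_length Q k) else 0.

Definition config_around (eps : R) (d : nat) Q : set (set (torus R)) :=
  [set translate (config_shift eps Q k) Q | k in [set k | (k < d)%N]].

Definition is_configuration (eps : R) (d : nat) (S : set (set (torus R))) :=
  exists m t, [/\ (0 < m)%N, Hset m t, (d <= size (exponents m))%N &
    S = config_around eps d (translate t (Vset m))].

Definition sh (S : set (set (torus R))) : set (torus R) := \bigcup_(E in S) E.

(* (S_j)_(j in J) is a family of disjoint (eps_j, d_j)-configurations *)
Definition disjoint_configurations (I : Type) (J : set I) (eps : I -> R)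
    (d : I -> nat) (S : I -> set (set (torus R))) : Prop :=
  (forall j, J j -> [/\ 0 < eps j <= 2^-1, (0 < d j)%N &
    is_configuration (eps j) (d j) (S j)]) /\
  trivIset J (fun j => sh (S j)).

End configurations.

(* The natural numbers start at 1 in this indexing of the configurations. *)
Definition pos_nat : set nat := [set j | (0 < j)%N].

Section maximal_operator.
Variables (R : realType) (mu : probability (torus R) R).
Implicit Types (f : torus R -> R) (p : \bar R) (K : \bar R).
Local Open Scope ereal_scope.

(* Averages are nonnegative, so adjoining 0 only matters when no B in Bs
   contains x, since the supremum of the empty set is -oo. *)
Definition maximal (Bs : set (set (torus R))) f (x : torus R) : \bar R :=
  ereal_sup (0 |` [set ((fine (mu B))^-1)%:E * \int[mu]_(y in B) (`|f y|)%:E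
                  | B in [set B | Bs B /\ B x]]).

(* K is an admissible constant in the weak type (p, p) inequality for [M];
   the exponent -oo is meaningless. *)
Definition weak_type_bound (M : (torus R -> R) -> torus R -> \bar R) p K :=
  match p with
  | r%:E => forall f, f \in Lfun mu r%:E -> forall lambda : R, (0 < lambda)%R ->
      lambda%:E * mu [set x | lambda%:E < M f x] `^ r^-1
        <= K * 'N[mu]_(r%:E)[EFin \o f]
  | +oo => forall f, f \in Lfun mu +oo ->
      'N[mu]_+oo[M f] <= K * 'N[mu]_+oo[EFin \o f]
  | -oo => False
  end.

Definition weak_norm (M : (torus R -> R) -> torus R -> \bar R) p : \bar R :=
  ereal_inf [set K | 0 <= K /\ weak_type_bound M p K].

Definition weakly_bounded (M : (torus R -> R) -> torus R -> \bar R) p : Prop :=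
  weak_norm M p < +oo.

End maximal_operator.

(* Main.v *)
Require Import Defs.
From mathcomp Require Import all_boot all_order all_algebra.
From mathcomp Require Import all_classical all_reals all_analysis.
From mathcomp Require Import measurable_realfun ess_sup_inf.
From mathcomp Require Import zify ring lra.

(* Translation invariance makes the coordinates of a point of the torus
   independent and uniformly distributed, so an (eps, d)-configuration
   {B_0, ..., B_(d-1)} around Q consists of sets of measure |Q| which are
   disjoint outside Q and whose traces on Q are independent of conditional
   probability eps.  Testing the maximal operator on the indicator of Q, whose
   average over each B_k is eps, gives eps * d^(1/p) <= 2 * 2^(1/p) * K.
   Conversely, let F index the B_k on which the average of |f| exceeds lambda,
   N = |F| and Y = sum_(k in F) 1_(B_k).  Then
   lambda * N * |Q| <= int |f| Y, and Young's inequality absorbs the Y-part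
   into the left-hand side once int Y^q <= C * N * |Q|.  Outside Q, Y <= 1; on
   Q, Y is binomial, and its q-th moment is controlled by its exponential moment
   at scale 1 + N * eps, which gives N + (N * eps)^q = N * (1 + (eps * N^(1/p))^q).
   These estimates are summed over the disjoint configurations. *)

Set Implicit Arguments.
Unset Strict Implicit.
Unset Printing Implicit Defensive.

Import Order.TTheory GRing.Theory Num.Theory.
Import numFieldNormedType.Exports.
Local Open Scope classical_set_scope.
Local Open Scope ring_scope.

(** * Circle arcs and the measure of boxes *)

Section additive.
Variable R : realType.

(** Nonnegativity and additivity make [F] nondecreasing. Additivity also gives
    [F (m / n) = (m / n) * F 1], and trapping [s] between consecutive multiples of [1 / n] forces
    [F s = s * F 1] as [n] grows. *)
Lemma additive_linear (F : R -> R) :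
  (forall s, 0 <= s -> 0 <= F s) ->
  (forall s t, 0 <= s -> 0 <= t -> s + t <= 1 -> F (s + t) = F s + F t) ->
  forall s, 0 <= s <= 1 -> F s = s * F 1.
Proof.
move=> F0 FD.
have Fle s t : 0 <= s -> s <= t -> t <= 1 -> F s <= F t.
  move=> s0 st t1; have -> : t = s + (t - s) by rewrite addrC subrK.
  by rewrite FD ?subr_ge0 ?lerDl ?F0 ?subr_ge0// addrC subrK.
have F00 : F 0 = 0.
  have := FD 0 0 (lexx _) (lexx _); rewrite addr0 => /(_ ler01) F00.
  by apply: (addrI (F 0)); rewrite addr0.
have FM (h : R) m : 0 <= h -> m%:R * h <= 1 -> F (m%:R * h) = m%:R * F h.
  move=> h0; elim: m => [|m ih] mh; first by rewrite !mul0r.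
  have mh' : m%:R * h <= 1.
    by apply: (le_trans _ mh); apply: ler_wpM2r => //; rewrite ler_nat.
  rewrite -[m.+1]addn1 natrD !mulrDl !mul1r FD ?mulr_ge0 ?ler0n// ?ih//.
  by move: mh; rewrite -[m.+1]addn1 natrD mulrDl mul1r.
move=> s /andP[s0]; rewrite le_eqVlt => /predU1P[->|s1]; first by rewrite mul1r.
(* With [h = 1 / n] and [m] the integer part of [n * s], both [F s] and [s * F 1] lie between
   [m * F h] and [(m + 1) * F h], so they differ by at most [F h = F 1 / n]. *)
have key n : (0 < n)%N -> n%:R * `|F s - s * F 1| <= F 1.
  move=> n0; have nR : 0 < n%:R :> R by rewrite ltr0n.
  set h : R := n%:R^-1; have h0 : 0 <= h by rewrite invr_ge0 ltW.
  have nh : n%:R * h = 1 by rewrite divff// gt_eqF.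
  have F1 : F 1 = n%:R * F h by rewrite -{1}nh FM// nh.
  have [m /andP[ms sm]] : exists m : nat, m%:R <= n%:R * s < m.+1%:R.
    by exists (Num.truncn (n%:R * s)); rewrite truncn_itv// mulr_ge0// ltW.
  have mn : (m < n)%N.
    by rewrite -(ltr_nat R); apply: le_lt_trans ms _; rewrite gtr_pMr.
  have mh k : (k <= n)%N -> k%:R * h <= 1.
    by move=> kn; rewrite -[leRHS]nh; apply: ler_wpM2r => //; rewrite ler_nat.
  have lo : m%:R * F h <= F s.
    rewrite -FM ?mh//; last exact: ltnW.
    apply: Fle; rewrite ?mulr_ge0 ?ler0n ?(ltW s1)//.
    by rewrite ler_pdivrMr// mulrC.
  have hi : F s <= m.+1%:R * F h.
    rewrite -FM ?mh//; apply: Fle; rewrite ?mh//.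
    by rewrite ler_pdivlMr// mulrC ltW.
  have Fh : 0 <= F h by exact: F0.
  rewrite -[X in X * _](ger0_norm (ltW nR)) -normrM F1 ler_norml.
  rewrite -[m.+1]addn1 natrD in hi sm.
  move: lo hi ms sm; set N := n%:R in nR *; set M := m%:R; set f := F h in Fh *.
  move=> lo hi ms sm.
  have lo' : N * (M * f) <= N * F s by rewrite ler_pM2l.
  have hi' : N * F s <= N * ((M + 1) * f) by rewrite ler_pM2l.
  have ms' : M * (N * f) <= N * s * (N * f) by rewrite ler_wpM2r// mulr_ge0// ltW.
  have sm' : N * s * (N * f) <= (M + 1) * (N * f).
    by rewrite ler_wpM2r ?mulr_ge0 ?(ltW nR)// ltW.
  by apply/andP; split; lra.
apply/eqP; rewrite -subr_eq0 -normr_le0 leNgt; apply/negP => d0.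
have := key (Num.truncn (F 1 / `|F s - s * F 1|)).+1 (ltn0Sn _).
rewrite -ler_pdivlMr// leNgt => /negP; apply.
exact: truncnS_gt.
Qed.

End additive.

Section circle_arcs.
Variable R : realType.
Implicit Types (x y : circle R).

Lemma circle_val_ge0 x : 0 <= circle_val x.
Proof. by have /andP[] := valP x. Qed.

Lemma circle_val_lt1 x : circle_val x < 1.
Proof. by have /andP[] := valP x. Qed.

Lemma circle_val_circ (s : R) : 0 <= s < 1 -> circle_val (circ s) = s.
Proof.
move=> s01 /=; have /eqP -> : Num.floor s == 0 by rewrite floor_eq mulr0z add0r.
by rewrite mulr0z subr0.
Qed.

Lemma circD (s t : R) : circ (s + t) = circ s + circ t.
Proof. by rewrite -circle_addE. Qed.

Lemma circ0 : circ (0 : R) = 0. Proof. by []. Qed.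

Lemma circN (s : R) : circ (- s) = - circ s.
Proof. by apply/eqP; rewrite -addr_eq0 -circD addNr. Qed.

(** The second case is the one where subtraction wraps around 0. The value [s = 1] always falls into
    it and gives back [circle_val x]. *)
Lemma circle_val_subcirc x (s : R) : 0 <= s <= 1 ->
  circle_val (x - circ s) =
  if s <= circle_val x then circle_val x - s else circle_val x - s + 1.
Proof.
move=> /andP[s0 s1]; have x0 := circle_val_ge0 x; have x1 := circle_val_lt1 x.
rewrite -[in LHS](circK x) -circN -circD; case: ifPn => sx.
  by rewrite circle_val_circ// subr_ge0 sx/= ltrBlDr (lt_le_trans x1)// lerDl.
rewrite -(circDz _ 1) circle_val_circ//; move: sx; rewrite -ltNge => sx.
by apply/andP; split; lra.
Qed.

(** Measuring from the starting point [a] treats arcs through 0 like all others. *)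
Definition arc (a L : R) : set (circle R) :=
  [set x | 0 < circle_val (x - circ a) < L].

Lemma arcE (a L : R) x : arc a L x = (0 < circle_val (x - circ a) < L) :> Prop.
Proof. by []. Qed.

(** The starting point is included, so that consecutive arcs tile without gaps and their measures
    add up exactly. *)
Definition half_open_arc (a L : R) : set (circle R) :=
  [set x | circle_val (x - circ a) < L].

Lemma half_open_arcD (s t : R) : 0 <= s -> 0 <= t -> s + t <= 1 ->
  half_open_arc 0 (s + t) = half_open_arc 0 s `|` half_open_arc s t /\
  half_open_arc 0 s `&` half_open_arc s t = set0.
Proof.
move=> s0 t0 st; have s1 : 0 <= s <= 1 by rewrite s0 (le_trans _ st)// lerDl.
rewrite /half_open_arc circ0; split; apply/seteqP; split => x;
  rewrite /setU /setI /set0 /mkset ?subr0 ?circle_val_subcirc//; case: ifPn;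
  have := circle_val_ge0 x; have := circle_val_lt1 x; rewrite -?ltNge.
- by move=> *; right; lra.
- by move=> *; left; lra.
- by move=> ? ? ? [|]; lra.
- by move=> ? ? ? [|]; lra.
- by move=> ? ? ? []; lra.
- by move=> ? ? ? []; lra.
Qed.

(** Since [2 * L <= 1], the shifted arc ends before it could come round the circle and meet the
    first arc again from behind. Only the last fraction [eps] of the first arc is shared. *)
Lemma arc_shiftI (a L eps : R) : 0 <= eps <= 1 -> 0 <= L <= 2^-1 ->
  arc a L `&` arc (a + (1 - eps) * L) L = arc (a + (1 - eps) * L) (eps * L).
Proof.
move=> /andP[e0 e1] /andP[L0 L2].
have e0L : 0 <= (1 - eps) * L by rewrite mulr_ge0 ?subr_ge0.
have e1L : (1 - eps) * L <= L by rewrite ler_piMl// gerBl.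
have s01 : 0 <= (1 - eps) * L <= 1 by rewrite e0L/=; lra.
apply/seteqP; split => x;
  rewrite /setI /mkset !arcE circD opprD addrA;
  rewrite (circle_val_subcirc _ s01);
  set v := circle_val (x - circ a); have v0 : 0 <= v := circle_val_ge0 _;
  have v1 : v < 1 := circle_val_lt1 _; case: (leP ((1 - eps) * L) v).
- by move=> ? [/andP[? ?] /andP[? ?]]; apply/andP; split; lra.
- by move=> ? [/andP[? ?] /andP[? ?]]; lra.
- by move=> ? /andP[? ?]; split; apply/andP; split; nra.
- by move=> ? /andP[? ?]; nra.
Qed.

End circle_arcs.

Section torus_measure.
Variable R : realType.
Local Notation torus := (torus R).

Lemma measurable_coord i (B : set R) : measurable B ->
  measurable [set x : torus | B (circle_val (x i))].
Proof. by move=> mB; apply: sub_sigma_algebra; exists i, B. Qed.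

(** In terms of representatives, subtracting [c] is a real translation followed by removal of the
    floor, which is monotone and hence Borel. *)
Lemma measurable_coordB i (c : circle R) (B : set R) : measurable B ->
  measurable [set x : torus | B (circle_val (x i - c))].
Proof.
move=> mB; pose h (v : R) := v + circle_val (- c) - (Num.floor (v + circle_val (- c)))%:~R.
have mh : measurable_fun setT h.
  apply: measurable_funB; first exact: measurable_funD.
  apply: nondecreasing_measurable => // s t st.
  by rewrite ler_int le_floor// lerD2r.
have mhB : measurable (h @^-1` B) by rewrite -[X in measurable X]setTI; exact: mh.
exact: (measurable_coord i mhB).
Qed.

Lemma measurable_coord_arc i (a L : R) :
  measurable [set x : torus | arc a L (x i)].
Proof.
have := @measurable_coordB i (circ a) `]0, L[%classic (measurable_itv _).
by congr measurable; apply/seteqP; split => x /=; rewrite in_itv.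
Qed.

Lemma measurable_coord_half_open_arc i (a L : R) :
  measurable [set x : torus | half_open_arc a L (x i)].
Proof.
have := @measurable_coordB i (circ a) `]-oo, L[%classic (measurable_itv _).
by congr measurable; apply/seteqP; split => x /=; rewrite in_itv.
Qed.

Definition single (k : nat) (s : circle R) : torus := fun i => if i == k then s else 0.

Variables (mu : probability torus R).
Hypothesis mu_haar : is_haar mu.

Section one_coordinate.
Variables (k : nat) (C : set torus).
Hypothesis mC : measurable C.
(** This says that membership in [C] does not depend on coordinate [k]. *)
Hypothesis C_inv : forall s x, C x -> C (x + single k s).

Let H (a L : R) := C `&` [set x | half_open_arc a L (x k)].

Let mH a L : measurable (H a L).
Proof. by apply: measurableI => //; exact: measurable_coord_half_open_arc. Qed.

Let mu_shift a L : mu (H a L) = mu (H 0 L).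
Proof.
rewrite -(mu_haar (single k (circ a)) (mH 0 L)); congr (mu _).
apply/seteqP; split => [x [Cx xa]|_ [x [Cx xa] <-]].
  exists (x + single k (circ (- a))).
    split; first exact: C_inv.
    change (circle_val ((x k + single k (circ (- a)) k) - circ 0) < L).
    by rewrite /single eqxx circN circ0 subr0.
  apply/funext => i; rewrite !fctE /single; case: eqP => _; last first.
    by rewrite add0r addr0.
  by rewrite circN addrC addrNK.
split; first by rewrite addrC; exact: C_inv.
change (circle_val ((single k (circ a) k + x k) - circ a) < L).
rewrite /single eqxx [circ a + _]addrC addrK.
by move: xa; rewrite /half_open_arc circ0 /mkset subr0.
Qed.

Let mu_half_open_arc a (L : R) : 0 <= L <= 1 -> mu (H a L) = (L%:E * mu C)%E.
Proof.
move=> L01; rewrite mu_shift.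
have fH L' : mu (H 0 L') = (fine (mu (H 0 L')))%:E by rewrite fineK ?fin_num_measure.
pose F L' := fine (mu (H 0 L')).
have F1 : mu C = (F 1)%:E.
  rewrite -fH; congr (mu _); apply/seteqP; split => [x Cx|x []//].
  split => //; exact: (circle_val_lt1 (x k - circ 0)).
(* An arc of length [s + t] splits into one of length [s] from 0 and one of length [t] from [s];
   invariance moves the latter back to 0. *)
rewrite F1 fH -EFinM; congr EFin; apply: (additive_linear (F := F)) => //.
  by move=> s _; rewrite fine_ge0.
move=> s t s0 t0 st; apply: EFin_inj; rewrite EFinD -!fH -(mu_shift s t).
have [E D] := half_open_arcD s0 t0 st.
rewrite -measureU//; last first.
  rewrite -subset0 => x [[_ xs] [_ xt]]; by have : set0 (x k) by rewrite -D; split.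
congr (mu _); rewrite /H -setIUr; congr (_ `&` _).
by apply/funext => x; rewrite /mkset E.
Qed.

(* The measure of half-open arcs, as a function of their length, is additive
   and monotone, hence linear; in particular endpoints are negligible. *)
Lemma measure_coord_arc a (L : R) : 0 <= L <= 1 ->
  mu (C `&` [set x | arc a L (x k)]) = (L%:E * mu C)%E.
Proof.
move=> L01; set A := _ `&` _.
pose Z := C `&` [set x | circle_val (x k - circ a) = 0].
have mZ : measurable Z by apply: measurableI => //; exact: measurable_coordB (measurable_set1 0).
have mA : measurable A by apply: measurableI => //; exact: measurable_coord_arc.
have Z0 : mu Z = 0%E.
  (* [Z] lies in half-open arcs of arbitrarily small length [d]; the minimum with 1 keeps [d] where
     the length formula applies. *)
  apply/eqP; rewrite eq_le measure_ge0 andbT; apply/lee_addgt0Pr => e e0.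
  rewrite add0e; pose d := Num.min e 1.
  have d0 : 0 < d by rewrite lt_min e0 ltr01.
  apply: (@le_trans _ _ (mu (H a d))).
    apply: le_measure; rewrite ?inE// => x [Cx /= xa]; split => //.
    by rewrite /half_open_arc/= xa.
  rewrite mu_half_open_arc ?(ltW d0) ?ge_min ?lexx ?orbT//.
  apply: (@le_trans _ _ (d%:E * 1)%E).
    by rewrite lee_pmul2l// probability_le1.
  by rewrite mule1 lee_fin ge_min lexx.
(* A half-open arc of length 0 is empty and does not contain its starting point, so the
   decomposition used below needs [L > 0]. *)
have [L0|L0] := eqVneq L 0.
  rewrite L0 mul0e (_ : A = set0) ?measure0// -subset0 => x [_].
  by rewrite /arc /mkset => /andP[h1 h2]; have := lt_trans h1 h2; rewrite L0 ltxx.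
have Lgt0 : 0 < L by case/andP: L01 => ? _; rewrite lt_neqAle eq_sym L0.
rewrite -(mu_half_open_arc a L01) -[LHS]adde0 -Z0 -measureU//; last first.
  rewrite -subset0 => x [[_]]; rewrite /arc /mkset => /andP[+ _] [_ xa].
  by rewrite /= in xa *; rewrite xa ltxx.
congr (mu _); rewrite /A /Z /H -setIUr; congr (_ `&` _).
apply/seteqP; split => x; rewrite /arc /half_open_arc /setU /mkset.
  by case => [/andP[]//|->].
move=> h; have := circle_val_ge0 (x k - circ a); rewrite le_eqVlt => /predU1P[<-|x0].
  by right.
by left; rewrite x0 h.
Qed.

End one_coordinate.

Definition arc_box n (a L : nat -> R) : set torus :=
  [set x | forall i, (i < n)%N -> arc (a i) (L i) (x i)].

Lemma arc_boxS n a L :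
  arc_box n.+1 a L = arc_box n a L `&` [set x | arc (a n) (L n) (x n)].
Proof.
apply/seteqP; split => [x xB|x [xB xn] i]; first by split => [i /ltnW|]; exact: xB.
by rewrite ltnS leq_eqVlt => /predU1P[->//|]; exact: xB.
Qed.

Lemma measurable_arc_box n a L : measurable (arc_box n a L).
Proof.
elim: n => [|n ih]; last first.
  by rewrite arc_boxS; apply: measurableI => //; exact: measurable_coord_arc.
by rewrite (_ : arc_box _ _ _ = setT)//; apply/seteqP; split.
Qed.

Lemma measure_arc_box n a L : (forall i, (i < n)%N -> 0 <= L i <= 1) ->
  mu (arc_box n a L) = (\prod_(i < n) L i)%:E.
Proof.
elim: n => [|n ih] L01.
  rewrite big_ord0 (_ : arc_box _ _ _ = setT) ?probability_setT//.
  by apply/seteqP; split.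
rewrite arc_boxS (measure_coord_arc (measurable_arc_box n a L)) ?L01//.
  by rewrite ih => [|i /ltnW /L01//]; rewrite big_ord_recr/= -EFinM mulrC.
move=> s x xB i iN; rewrite fctE /single ltn_eqF// addr0; exact: xB.
Qed.

End torus_measure.

(** * Geometry of configurations *)

Section overlapping_families.
Context d (T : measurableType d) (R : realType).

(* The properties of the configuration {B_0, ..., B_(n-1)} around Q that matter
   for the maximal operator: outside Q the sets are disjoint, inside Q they are
   independent events of conditional probability eps. *)
Record overlapping (mu : probability T R) (eps : R) (n : nat) (Q : set T)
    (B : nat -> set T) : Prop := Overlapping {
  ovl_mcore : measurable Q;
  ovl_msets : forall k, measurable (B k);
  ovl_core_gt0 : (0 < mu Q)%E;
  ovl_mu_sets : forall k, (k < n)%N -> mu (B k) = mu Q;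
  ovl_setI : forall k l, (k < n)%N -> (l < n)%N -> k != l -> B k `&` B l `<=` Q;
  ovl_indep : forall G : seq nat, uniq G -> {in G, forall k, (k < n)%N} ->
    mu (Q `&` [set x | {in G, forall k, B k x}]) = ((eps ^+ size G)%:E * mu Q)%E
}.

End overlapping_families.

Lemma exponents_gt0 m i : (0 < m)%N -> (i < size (exponents m))%N ->
  (0 < nth 0 (exponents m) i)%N.
Proof.
move=> m0 im; suff /allP : all (leq 1) (exponents m) by apply; exact: mem_nth.
rewrite /exponents; set n := bigop.body _ _ _.
(* This bound makes [j = m - n ^ 2] positive, also when the maximum ranges over no suitable index
   and equals 0. *)
have nm : (n ^ 2 < m)%N.
  rewrite /n; apply: (big_ind (fun x => x ^ 2 < m)%N) => //= x y xm ym.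
  by rewrite /maxn; case: ifP.
case: ifP => jn; first by rewrite all_rcons subn_gt0 nm all_nseq /= lt0n orbN.
(* For [n = 0] the second block would consist of zeros, but its length [1 - j] is 0. *)
rewrite all_cat !all_nseq /= orbT/=; case: (posnP n) => [n0|_]; last by rewrite orbT.
by move: jn nm; rewrite n0; lia.
Qed.

Section configuration_geometry.
Variables (R : realType).

Lemma arc_circ (a L s : R) : 0 < s < L -> L <= 1 -> arc a L (circ (a + s)).
Proof.
move=> /andP[s0 sL] L1; rewrite arcE circD [circ a + _]addrC addrK circle_val_circ ?s0//.
by rewrite ltW//= (lt_le_trans sL).
Qed.

Lemma translate_arc_box n (a L : nat -> R) (t : torus R) :
  translate t (arc_box n a L) = arc_box n (fun i => a i + circle_val (t i)) L.
Proof.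
apply/seteqP; split => [_ [x xB <-] i iN|x xB].
  rewrite arcE circD circK fctE [t i + _]addrC opprD addrACA subrr addr0.
  exact: xB.
exists (x - t); last by rewrite addrC subrK.
move=> i iN; have := xB i iN.
by rewrite !arcE circD circK opprD [- circ _ - _]addrC addrA.
Qed.

Lemma translate_Vset m (t : torus R) :
  translate t (@Vset R m) = arc_box (size (exponents m)) (fun i => circle_val (t i))
    (fun i => 2 ^- nth 0%N (exponents m) i).
Proof.
have -> : @Vset R m = arc_box (size (exponents m)) (fun=> 0)
    (fun i => 2 ^- nth 0%N (exponents m) i).
  apply/seteqP; split => x xV i im; have := xV i im.
    by rewrite arcE circ0 subr0.
  by rewrite arcE circ0 subr0.
by rewrite translate_arc_box; congr arc_box; apply/funext => i; rewrite add0r.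
Qed.

(** The condition [a k + L k <= 1] prevents the [k]-th arc from wrapping around 0, so its
    representatives form a single interval. *)
Lemma proj_length_arc_box n (a L : nat -> R) k : (k < n)%N ->
  (forall i, (i < n)%N -> 0 < L i <= 1) -> 0 <= a k -> a k + L k <= 1 ->
  proj_length (arc_box n a L) k = L k.
Proof.
move=> kn L01 ak0 akL; have /andP[Lk0 Lk1] := L01 k kn.
have pE : [set circle_val (x k) | x in arc_box n a L] = `](a k), (a k + L k)[%classic.
  apply/seteqP; split => [_ [x xB <-]|v].
    have := xB k kn; rewrite arcE circle_val_subcirc; last first.
      by rewrite ak0/=; lra.
    have := circle_val_lt1 (x k); have := circle_val_ge0 (x k).
    rewrite /mkset in_itv/=; case: (leP (a k) (circle_val (x k))) => xa x0 x1 /andP[? ?];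
      last by exfalso; lra.
    by apply/andP; split; lra.
  rewrite /mkset in_itv/= => /andP[av va].
  (* The coordinates other than [k] are put at the midpoints of their arcs. *)
  exists (fun i => circ (a i + if i == k then v - a k else L i / 2)).
    move=> i iN; have /andP[Li0 Li1] := L01 i iN; apply: arc_circ => //.
    by case: eqP => [->|_]; apply/andP; split; lra.
  rewrite eqxx addrC subrK circle_val_circ//; apply/andP; split; lra.
rewrite /proj_length pE lebesgue_measure_itv/= lte_fin ltrDl Lk0 /=.
by rewrite addrAC subrr add0r.
Qed.

Lemma prod_if_mem n (G : seq nat) (e : R) : uniq G -> {in G, forall k, (k < n)%N} ->
  \prod_(i < n) (if nat_of_ord i \in G then e else 1) = e ^+ size G.
Proof.
move=> uG Gn.
rewrite -(big_mkord xpredT (fun i => if i \in G then e else 1)) -big_mkcond -big_filter.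
rewrite (perm_big G)/=; first by rewrite big_const_seq count_predT iter_mulr_1.
apply: uniq_perm => //; first by rewrite filter_uniq// iota_uniq.
move=> i; rewrite mem_filter mem_index_iota /=.
by case: (boolP (i \in G)) => //= /Gn ->.
Qed.

(** Every set involved is an arc box. [B k] differs from [Q] only in coordinate [k], so a point of
    two different sets satisfies all the constraints of [Q]. Intersecting [Q] with the [B k] for [k]
    in [G] shrinks exactly the sides indexed by [G] by the factor [eps]. *)
Lemma configuration_overlapping (mu : probability (torus R) R) (eps : R) d S :
  is_haar mu -> 0 < eps <= 2^-1 -> is_configuration eps d S ->
  exists Q B, overlapping mu eps d Q B /\ S = [set B k | k in [set k | (k < d)%N]].
Proof.
move=> mu_haar /andP[e0 e2] [m [t [m0 [Ht _] dm ->]]].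
rewrite translate_Vset; set n := size _ in dm *.
pose L i : R := 2 ^- nth 0%N (exponents m) i.
pose a i := circle_val (t i); rewrite -/L -/a.
have L2 i : (i < n)%N -> 0 < L i <= 2^-1.
  move=> im; rewrite invr_gt0 exprn_gt0//= lef_pV2 ?posrE ?exprn_gt0//.
  rewrite -[leLHS]expr1 ler_weXn2l ?ler1n//; exact: exponents_gt0.
have L1 i : (i < n)%N -> 0 < L i <= 1.
  by move=> /L2 /andP[-> /le_trans]; apply; rewrite invf_le1 ?ler1n.
(* As [t] belongs to [H_m], its coordinate [k] is [c * L k] with [c + 1] at most [1 / L k]; hence
   the arc does not wrap. *)
have projL k : (k < n)%N -> proj_length (arc_box n a L) k = L k.
  move=> kn; have [c c2 tk] := Ht k kn; have /andP[Lk0 Lk1] := L1 k kn.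
  have cL : c%:R * L k + L k <= 1.
    rewrite -[X in _ + X]mul1r -mulrDl natr1 ler_pdivrMr ?exprn_gt0// mul1r.
    by rewrite -natrX ler_nat.
  have ak : a k = c%:R * L k.
    rewrite /a tk circle_val_circ// mulr_ge0 ?(ltW Lk0)//=.
    by apply: lt_le_trans cL; rewrite ltrDl.
  by apply: proj_length_arc_box => //; rewrite ak// mulr_ge0 ?(ltW Lk0).
(* These are the starting points after shifting every coordinate in [G]: singletons give the sets
   [B k], larger [G] the multiple intersections. *)
pose a' (G : seq nat) i := if i \in G then a i + (1 - eps) * L i else a i.
pose B (k : nat) : set (torus R) := arc_box n (a' [:: k]) L.
have BE k : (k < d)%N ->
    translate (config_shift eps (arc_box n a L) k) (arc_box n a L) = B k.
  move=> kd; have kn := leq_trans kd dm; rewrite translate_arc_box.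
  congr arc_box; apply/funext => i; rewrite /config_shift /a' inE; case: eqP => [->|_].
    rewrite projL// circle_val_circ//; have /andP[? ?] := L1 k kn; apply/andP; split; nra.
  by rewrite -circ0 circle_val_circ ?addr0 ?lexx ?ltr01.
exists (arc_box n a L), B; split; last first.
  by rewrite /config_around; apply: eq_imagel => k /BE.
have muL a1 : mu (arc_box n a1 L) = (\prod_(i < n) L i)%:E.
  by apply: measure_arc_box => // i /L1 /andP[/ltW -> ->].
split => //.
- exact: measurable_arc_box.
- by move=> k; exact: measurable_arc_box.
- by rewrite muL lte_fin prodr_gt0// => i _; have /andP[] := L1 i (ltn_ord i).
- by move=> k _; rewrite /B !muL.
- move=> k l kd ld kl x [xk xl] i iN; have := xk i iN; have := xl i iN.
  by rewrite /a' !inE; case: (i =P k) => [->|//]; rewrite (negbTE kl).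
- move=> G uG Gd; pose L' i := (if i \in G then eps else 1) * L i.
  have -> : arc_box n a L `&` [set x | {in G, forall k, B k x}] = arc_box n (a' G) L'.
    apply/seteqP; split => [x [xQ xG] i iN|x xG].
      rewrite /a' /L'; case: ifPn => iG; last by rewrite mul1r; exact: xQ.
      rewrite -arc_shiftI; first by split; [exact: xQ|have := xG i iG i iN; rewrite /a' inE eqxx].
        by rewrite ltW//=; lra.
      by have /andP[/ltW -> ->] := L2 i iN.
    have xQ i : (i < n)%N -> arc (a i) (L i) (x i) /\
        (i \in G -> arc (a i + (1 - eps) * L i) (L i) (x i)).
      move=> iN; have := xG i iN; rewrite /a' /L'; case: ifPn; last by rewrite mul1r.
      rewrite -arc_shiftI; [by move=> _ []|by rewrite ltW//=; lra|].
      by have /andP[/ltW -> ->] := L2 i iN.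
    split => [i /xQ[]//|k kG i iN]; rewrite /a' inE; have [xi xGi] := xQ i iN.
    by case: eqP => // ik; apply: xGi; rewrite ik.
  rewrite muL measure_arc_box//; last first.
    move=> i iN; rewrite /L'; have /andP[? ?] := L1 i iN.
    by case: ifP => _; apply/andP; split; nra.
  rewrite big_split/= -EFinM prod_if_mem// => k /Gd kd; exact: leq_trans dm.
Qed.

End configuration_geometry.

(** * Moments of the overlap function *)

Section real_inequalities.
Variable R : realType.
Implicit Types (p q x s : R).

(** Young's inequality is applied to [tau ^ (-1/q) * u / lam] and [tau ^ (1/q) * v], then multiplied
    by [lam]. The constant [D] is independent of [lam], and [tau] can be made small enough for
    absorption. *)
Lemma young_scaled p q (tau : R) : 0 < p -> 0 < q -> 1 < p -> 1 < q -> p^-1 + q^-1 = 1 ->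
  0 < tau -> exists2 D : R, 0 < D & forall lam u v : R, 0 < lam -> 0 <= u -> 0 <= v ->
    u * v <= D * lam `^ (1 - p) * u `^ p + lam * tau * v `^ q.
Proof.
move=> p0 q0 p1 q1 pq t0; exists (tau `^ (- (p / q))); first exact: powR_gt0.
move=> lam u v lam0 u0 v0.
have i0 : 0 <= lam^-1 by rewrite invr_ge0 ltW.
pose a := tau `^ (- q^-1) * (lam^-1 * u); pose b := tau `^ q^-1 * v.
have a0 : 0 <= a by rewrite !mulr_ge0// powR_ge0.
have b0 : 0 <= b by rewrite mulr_ge0// powR_ge0.
have -> : u * v = lam * (a * b).
  rewrite /a /b mulrACA -powRD ?addNr ?eqxx ?powRr0 ?mul1r ?(gt_eqF t0)//.
  by rewrite !mulrA divff ?mul1r// gt_eqF.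
have -> : tau `^ (- (p / q)) * lam `^ (1 - p) * u `^ p = lam * a `^ p.
  rewrite /a !powRM ?powR_ge0 ?mulr_ge0// -powRrM mulNr [q^-1 * p]mulrC.
  rewrite powRD ?(gt_eqF lam0) ?implybT// powRr1 ?ltW// -(powR_inv1 (ltW lam0)) -powRrM mulN1r.
  by rewrite -!mulrA mulrCA.
have -> : lam * tau * v `^ q = lam * b `^ q.
  by rewrite /b powRM ?powR_ge0// -powRrM mulVf ?gt_eqF// powRr1 ?ltW// mulrA.
rewrite -mulrDr ler_pM2l//; apply: (le_trans (conjugate_powR a0 b0 p0 q0 pq)).
by rewrite lerD// ler_piMr ?powR_ge0// invf_le1// ltW.
Qed.

(** This is the [q]-th power of [x / q <= expR (x / q)]. *)
Lemma powR_le_expR q x : 0 < q -> 0 <= x -> x `^ q <= q `^ q * expR x.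
Proof.
move=> q0 x0; have -> : x = q * (x / q) by rewrite mulrCA divff ?mulr1// gt_eqF.
have xq0 : 0 <= x / q by rewrite divr_ge0// ltW.
rewrite powRM ?(ltW q0)// ler_wpM2l ?powR_ge0//.
rewrite [q * _]mulrC expRM ge0_ler_powR ?nnegrE ?expR_ge0 ?(ltW q0)//.
by apply: le_trans (expR_ge1Dx _); rewrite lerDr ler01.
Qed.

(** From [1 - s <= expR (- s)] follow [expR s <= 2] and [expR s - 1 <= s * expR s]. *)
Lemma expR_sub1_le s : 0 <= s <= 2^-1 -> expR s - 1 <= 2 * s.
Proof.
move=> /andP[s0 s2]; have es := expR_gt0 s.
have : (1 - s) * expR s <= 1.
  by rewrite -ler_pdivlMr// div1r -expRN; exact: expR_ge1Dx.
nra.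
Qed.

End real_inequalities.

Section upper_bound.
Context d (T : measurableType d) (R : realType) (mu : probability T R).
Variables (eps : R) (n : nat) (Q : set T) (B : nat -> set T).
Hypotheses (eps0 : 0 < eps) (QB : overlapping mu eps n Q B).

Let mQ : measurable Q. Proof. exact: ovl_mcore QB. Qed.
Let mB k : measurable (B k). Proof. exact: (ovl_msets QB k). Qed.

Let m : R := fine (mu Q).
Let muQ : mu Q = m%:E. Proof. by rewrite fineK ?fin_num_measure. Qed.
Let m0 : 0 < m. Proof. by rewrite -lte_fin -muQ; exact: ovl_core_gt0 QB. Qed.

Let mI (G : seq nat) : measurable [set x | {in G, forall k, B k x}].
Proof.
rewrite (_ : [set x | _] = \bigcap_(k in [set k | k \in G]) B k).
  exact: bigcap_measurableType.
by apply/seteqP; split => x h k /h.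
Qed.

Lemma integral_indicM (E A : set T) (g : T -> \bar R) :
  (\int[mu]_(x in E) ((\1_A x)%:E * g x) = \int[mu]_(x in E `&` A) g x)%E.
Proof.
rewrite integral_mkcondr; apply: eq_integral => x _.
by rewrite patchE indicE; case: (x \in A); rewrite ?mul1e ?mul0e.
Qed.

(** The list [G] of events already imposed makes the induction on [F] work: expanding the first
    factor leaves one term with [G] unchanged and one with [k] moved into [G]. With [G] empty and
    [c = expR s - 1] this is the generating function of a binomial variable. *)
Lemma integral_prod_independent (c : R) (F G : seq nat) : 0 <= c ->
  uniq (F ++ G) -> {in F ++ G, forall k, (k < n)%N} ->
  (\int[mu]_(x in Q `&` [set x | {in G, forall k, B k x}])
      (\prod_(k <- F) (1 + c * \1_(B k) x))%:E
   = (eps ^+ size G * (1 + c * eps) ^+ size F * m)%:E)%E.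
Proof.
move=> c0; elim: F G => [|k F ih] G; rewrite ?cat0s => uFG FGn.
  under eq_integral do rewrite big_nil.
  rewrite integral_cst ?mul1e ?mulr1.
    by rewrite /= ?expr0 ?mulr1 EFinM -muQ; exact: (ovl_indep QB uFG FGn).
  exact: measurableI.
set E := Q `&` _; pose g x := \prod_(j <- F) (1 + c * \1_(B j) x).
have mg : measurable_fun setT g.
  apply: measurable_prod => j _; apply: measurable_funD => //.
  by apply: measurable_funM => //; exact: measurable_indic.
have g0 x : 0 <= g x.
  by apply: prodr_ge0 => j _; rewrite addr_ge0// mulr_ge0// indicE ler0n.
have mE : measurable E by exact: measurableI.
have -> : (\int[mu]_(x in E) (\prod_(j <- k :: F) (1 + c * \1_(B j) x))%:E
    = \int[mu]_(x in E) ((g x)%:E + c%:E * ((\1_(B k) x)%:E * (g x)%:E)))%E.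
  by apply: eq_integral => x _; rewrite big_cons -/(g x) mulrDl mul1r EFinD !EFinM muleA.
rewrite ge0_integralD//; last 4 first.
- by move=> x _; rewrite lee_fin.
- by apply/measurable_EFinP; exact: measurable_funTS.
- by move=> x _; rewrite -!EFinM lee_fin !mulr_ge0// indicE ler0n.
- apply: measurable_funTS; apply: measurable_funeM; apply/measurable_EFinP.
  by apply: measurable_funM => //; exact: measurable_indic.
rewrite ge0_integralZl_EFin//; last 2 first.
- by move=> x _; rewrite -!EFinM lee_fin !mulr_ge0// indicE ler0n.
- apply: measurable_funTS; apply/measurable_EFinP.
  by apply: measurable_funM => //; exact: measurable_indic.
rewrite integral_indicM.
have -> : E `&` B k = Q `&` [set x | {in k :: G, forall j, B j x}].
  rewrite /E -setIA; congr (_ `&` _); apply/seteqP; split => x.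
    by case=> h xk j; rewrite inE => /predU1P[->//|/h].
  by move=> h; split; [move=> j jG|]; apply: h; rewrite inE ?jG ?orbT ?eqxx.
have uk : uniq (F ++ k :: G) by rewrite -cat1s uniq_catCA cat1s.
rewrite ih; [|by move: uFG => /= /andP[]|by move=> j jF; apply: FGn; rewrite inE jF orbT].
rewrite ih//; last first.
  by move=> j jF; apply: FGn; move: jF; rewrite /= inE !mem_cat inE orbCA.
by rewrite -EFinM -EFinD /= !exprS; congr EFin; ring.
Qed.

Variables (F : seq nat).
Hypotheses (uF : uniq F) (Fn : {in F, forall k, (k < n)%N}).

Let Y x : R := \sum_(k <- F) \1_(B k) x.
Let N : R := (size F)%:R.

Let mY : measurable_fun setT Y.
Proof. by apply: measurable_sum => k; exact: measurable_indic. Qed.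

Let Y0 x : 0 <= Y x.
Proof. by apply: sumr_ge0 => k _; rewrite indicE ler0n. Qed.

Lemma integral_overlap_sum : (\int[mu]_x (Y x)%:E = (N * m)%:E)%E.
Proof.
under eq_integral do rewrite /Y -sumEFin.
rewrite ge0_integral_sum//; last by move=> k; apply/measurable_EFinP; exact: measurable_indic.
rewrite (eq_big_seq (fun=> m%:E)) => [|k kF].
  by rewrite sumEFin big_const_seq count_predT iter_addr_0 mulr_natl.
by rewrite integral_indic// setIT -muQ; exact: (ovl_mu_sets QB (Fn kF)).
Qed.

Lemma overlap_sum_le1 x : ~ Q x -> Y x = 0 \/ Y x = 1.
Proof.
move=> Qx; have [[k kF Bk]|noB] := pselect (exists2 k, k \in F & B k x).
  right; rewrite /Y (bigD1_seq k)//= indicE mem_set// big1_seq ?addr0// => l /andP[lk lF].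
  rewrite indicE memNset// => Bl; apply: Qx; by apply: (ovl_setI QB (Fn lF) (Fn kF) lk); split.
left; rewrite /Y big1_seq// => k /= kF; rewrite indicE memNset// => Bk.
by apply: noB; exists k.
Qed.

(** [expR (s * Y)] is the product of the factors [1 + (expR s - 1) * \1_(B k)], so its mean over [Q]
    is [(1 + (expR s - 1) * eps) ^ N], at most [expR (2 * s * eps * N)]. *)
Lemma integral_expR_overlap_sum (s : R) : 0 <= s <= 2^-1 -> 2 * s * eps * N <= 1 ->
  (\int[mu]_(x in Q) (expR (s * Y x))%:E <= (expR 1 * m)%:E)%E.
Proof.
move=> s2 sN; have es : 0 <= expR s - 1.
  by rewrite subr_ge0 -expR0 ler_expR; case/andP: s2.
have := @integral_prod_independent (expR s - 1) F [::] es.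
rewrite cats0 => /(_ uF Fn); rewrite expr0 mul1r.
rewrite (_ : _ `&` _ = Q); last by apply/seteqP; split => [x []|x Qx].
have -> : (\int[mu]_(x in Q) (\prod_(k <- F) (1 + (expR s - 1) * \1_(B k) x))%:E
    = \int[mu]_(x in Q) (expR (s * Y x))%:E)%E.
  apply: eq_integral => x _; rewrite /Y mulr_sumr expR_sum; congr EFin.
  apply: eq_bigr => k _; rewrite indicE; case: (_ \in _).
    by rewrite !mulr1 addrC subrK.
  by rewrite !mulr0 addr0 expR0.
move=> ->; rewrite lee_fin ler_wpM2r ?(ltW m0)//.
apply: (@le_trans _ _ (expR ((expR s - 1) * eps) ^+ size F)).
  rewrite lerXn2r ?nnegrE ?expR_ge0 ?expR_ge1Dx// addr_ge0// mulr_ge0// ltW//.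
rewrite -expRM_natl ler_expR; apply: le_trans sN.
rewrite mulrC ler_wpM2r ?ler0n// ler_wpM2r ?(ltW eps0)//; exact: expR_sub1_le.
Qed.

Lemma integral_powR_overlap_sum p q A : 1 < p -> 1 < q -> p^-1 + q^-1 = 1 ->
  eps * n%:R `^ p^-1 <= A ->
  (\int[mu]_x (Y x `^ q)%:E <=
    ((1 + (4 * q) `^ q * expR 1 * (1 + A `^ q)) * (N * m))%:E)%E.
Proof.
move=> p1 q1 pq epsA.
have p0 : 0 < p by apply: lt_trans p1. have q0 : 0 < q by apply: lt_trans q1.
have [F0|FN] := posnP (size F).
  rewrite integral0_eq ?lee_fin /N ?F0 ?mul0r ?mulr0// => x _.
  by rewrite /Y (size0nil F0) big_nil powR0// gt_eqF.
have N1 : 1 <= N by rewrite ler1n.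
have A0 : 0 <= A by apply: le_trans epsA; rewrite mulr_ge0 ?powR_ge0 ?(ltW eps0).
have eN0 : 0 <= eps * N by rewrite mulr_ge0 ?(ltW eps0)// ler0n.
(* At this scale (expR M^-1 - 1) * eps * N <= 1. *)
pose M := 2 * (1 + eps * N).
have M2 : 2 <= M by rewrite /M; lra.
have M0 : 0 < M by lra.
(* [M] is at most 4 times the larger of 1 and [eps * N]. Since [q / p = q - 1], [(eps * N) ^ q =
   (eps * N ^ (1/p)) ^ q * N], and [N <= n] because [F] has no repetitions. *)
have Mq : M `^ q <= 4 `^ q * ((1 + A `^ q) * N).
  apply: (@le_trans _ _ ((4 * Num.max 1 (eps * N)) `^ q)).
    rewrite ge0_ler_powR ?nnegrE ?(ltW M0) ?(ltW q0)//.
      by rewrite mulr_ge0// le_max ler01.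
    have h1 : 1 <= Num.max 1 (eps * N) by rewrite le_max lexx.
    have h2 : eps * N <= Num.max 1 (eps * N) by rewrite le_max lexx orbT.
    by rewrite /M; lra.
  rewrite powRM ?le_max ?ler01// ler_wpM2l ?powR_ge0//.
  rewrite maxEle; case: ifP => _; last first.
    by rewrite powR1; have := powR_ge0 A q; nra.
  have -> : (eps * N) `^ q = (eps * N `^ p^-1) `^ q * N.
    have N0 : 0 <= N by rewrite ler0n.
    have pqE : p^-1 * q = q - 1.
      have -> : p^-1 = 1 - q^-1 by lra.
      by rewrite mulrBl mul1r mulVf// gt_eqF.
    rewrite !powRM ?powR_ge0 ?(ltW eps0)// -powRrM pqE -mulrA; congr (_ * _).
    by rewrite mulrC mulr_powRB1.
  rewrite ler_wpM2r ?ler0n//.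
  have : (eps * N `^ p^-1) `^ q <= A `^ q.
    rewrite ge0_ler_powR ?nnegrE ?(ltW q0)// ?mulr_ge0 ?powR_ge0 ?(ltW eps0)//.
    apply: le_trans epsA; rewrite ler_wpM2l ?(ltW eps0)//.
    rewrite ge0_ler_powR ?nnegrE ?ler0n ?invr_ge0 ?(ltW p0)// ler_nat.
    rewrite -(size_iota 0 n); apply: uniq_leq_size => // k /Fn kn.
    by rewrite mem_iota.
  by lra.
(* [h] dominates [Y ^ q]: outside [Q] the value of [Y] is 0 or 1, and on [Q] the exponential bound
   is applied to [Y / M]. *)
pose h x := Y x + q `^ q * M `^ q * (\1_Q x * expR (M^-1 * Y x)).
have mexp : measurable_fun setT (fun x => expR (M^-1 * Y x)).
  by apply: measurableT_comp => //; exact: measurable_funM.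
have c0 : 0 <= q `^ q * M `^ q by rewrite mulr_ge0 ?powR_ge0.
apply: (@le_trans _ _ (\int[mu]_x (h x)%:E)%E).
  apply: ge0_le_integral => //.
  - by move=> x _; rewrite lee_fin powR_ge0.
  - apply/measurable_EFinP.
    by apply: (measurableT_comp (measurable_powR q)).
  - apply/measurable_EFinP; apply: measurable_funD => //; apply: measurable_funM => //.
    by apply: measurable_funM => //; exact: measurable_indic.
  move=> x _; rewrite lee_fin /h; have [Qx|Qx] := pselect (Q x).
    rewrite indicE mem_set// mul1r ler_wpDl ?Y0//.
    have -> : Y x = M * (M^-1 * Y x) by rewrite mulrA divff ?mul1r// gt_eqF.
    have ? : 0 <= M^-1 * Y x by rewrite mulr_ge0 ?invr_ge0 ?(ltW M0) ?Y0.
    rewrite [X in _ <= _ * expR (M^-1 * X)]mulrA divff ?gt_eqF// mul1r.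
    rewrite powRM ?(ltW M0)// [q `^ q * _]mulrC -mulrA ler_wpM2l ?powR_ge0//.
    exact: powR_le_expR.
  rewrite indicE memNset// mul0r mulr0 addr0.
  by case: (overlap_sum_le1 Qx) => ->; rewrite ?powR1 ?powR0// gt_eqF.
rewrite /h; under eq_integral do rewrite EFinD.
rewrite ge0_integralD//; last 4 first.
- by move=> x _; rewrite lee_fin.
- exact/measurable_EFinP.
- by move=> x _; rewrite lee_fin !mulr_ge0 ?expR_ge0 ?powR_ge0// indicE ler0n.
- apply/measurable_EFinP; apply: measurable_funM => //.
  by apply: measurable_funM => //; exact: measurable_indic.
rewrite integral_overlap_sum; under eq_integral do rewrite EFinM [(\1_Q _ * _)%:E]EFinM.
rewrite ge0_integralZl_EFin//; last first.
  by apply/measurable_EFinP; apply: measurable_funM => //; exact: measurable_indic.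
rewrite integral_indicM setTI mulrDl mul1r EFinD leeD2l//.
apply: (@le_trans _ _ ((q `^ q * M `^ q)%:E * (expR 1 * m)%:E)%E).
  rewrite lee_wpmul2l ?lee_fin//; apply: integral_expR_overlap_sum.
    by rewrite invr_ge0 (ltW M0)/= lef_pV2 ?posrE.
  have -> : 2 * M^-1 * eps * N = M^-1 * (2 * (eps * N)) by ring.
  by rewrite mulrC ler_pdivrMr// mul1r /M; lra.
rewrite -EFinM lee_fin [(4 * q) `^ q]powRM ?(ltW q0)//.
have -> : 4 `^ q * q `^ q * expR 1 * (1 + A `^ q) * (N * m)
  = q `^ q * (4 `^ q * ((1 + A `^ q) * N)) * (expR 1 * m) by ring.
by rewrite ler_wpM2r ?mulr_ge0 ?expR_ge0 ?(ltW m0)// ler_wpM2l ?powR_ge0.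
Qed.

End upper_bound.

(** * A single configuration *)

Section weak_type_one_configuration.
Context d (T : measurableType d) (R : realType) (mu : probability T R).

(** [C] is chosen before the configuration and depends only on [p] and [A], which is what allows
    summation over infinitely many configurations. *)
Lemma overlapping_weak_type (p A : R) : 1 < p -> exists2 C : R, 0 < C &
  forall (eps : R) (n : nat) (Q : set T) (B : nat -> set T) (F : seq nat)
    (f : T -> R) (lam : R),
  0 < eps -> eps * n%:R `^ p^-1 <= A -> overlapping mu eps n Q B ->
  uniq F -> {in F, forall k, (k < n)%N} -> measurable_fun setT f -> 0 < lam ->
  {in F, forall k, (lam%:E * mu Q <= \int[mu]_(x in B k) (`|f x|)%:E)%E} ->
  ((lam `^ p)%:E * mu (\bigcup_(k in [set k | k \in F]) B k) <=
   C%:E * \int[mu]_(x in \bigcup_(k in [set k | k \in F]) B k) (`|f x| `^ p)%:E)%E.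
Proof.
move=> p1; have p0 : 0 < p by apply: lt_trans p1.
have pB1 : 0 < p - 1 by rewrite subr_gt0.
pose q := p / (p - 1).
have q1 : 1 < q by rewrite ltr_pdivlMr// mul1r ltrBlDr ltrDl.
have q0 : 0 < q by apply: lt_trans q1.
have pq : p^-1 + q^-1 = 1 by rewrite /q invf_div; field; rewrite gt_eqF// gt_eqF.
pose C1 : R := 1 + (4 * q) `^ q * expR 1 * (1 + A `^ q).
have C1_gt0 : 0 < C1.
  by rewrite /C1 ltr_pwDl// !mulr_ge0 ?addr_ge0 ?powR_ge0 ?expR_ge0.
(* With this choice the [Y]-term of Young's inequality is at most half of [lam * N * m]. *)
pose tau := (2 * C1)^-1.
have tau0 : 0 < tau by rewrite invr_gt0 mulr_gt0.
have [D D0 young] := young_scaled p0 q0 p1 q1 pq tau0.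
exists (2 * D); first by rewrite mulr_gt0.
move=> eps n Q B F f lam eps0 epsA QB uF Fn mf lam0 flam.
set U := \bigcup_(k in _) _.
have mB k : measurable (B k) by exact: (ovl_msets QB k).
have mU : measurable U by apply: bigcup_measurable => k _.
pose Y x : R := \sum_(k <- F) \1_(B k) x.
have mY : measurable_fun setT Y by apply: measurable_sum => k; exact: measurable_indic.
have Y0 x : 0 <= Y x by apply: sumr_ge0 => k _; rewrite indicE ler0n.
have mYq : measurable_fun setT (fun x => Y x `^ q).
  by apply: (measurableT_comp (measurable_powR q)).
have mabsf : measurable_fun setT (fun x => `|f x|) by exact: measurableT_comp.
have mfp : measurable_fun setT (fun x => `|f x| `^ p).
  by apply: (measurableT_comp (measurable_powR p)).
pose N : R := (size F)%:R; pose m : R := fine (mu Q).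
have muQ : mu Q = m%:E by rewrite fineK ?fin_num_measure//; exact: (ovl_mcore QB).
have m0 : 0 < m by rewrite -lte_fin -muQ; exact: (ovl_core_gt0 QB).
have N0 : 0 <= N by rewrite ler0n.
have muU : (mu U <= (N * m)%:E)%E.
  rewrite -(integral_overlap_sum QB Fn) -[mu U]mul1e -integral_cst//.
  rewrite integral_mkcond; apply: ge0_le_integral => //.
  - by move=> x _; apply: erestrict_ge0.
  - by apply/(measurable_restrictT _ _).1.
  - exact/measurable_EFinP.
  move=> x _; rewrite patchE; case: ifPn => [/set_mem[k kF Bk]|_]; last by rewrite lee_fin Y0.
  by rewrite lee_fin (big_rem k)//= indicE mem_set// lerDl sumr_ge0.
set I := (\int[mu]_(x in U) _)%E.
have I0 : (0 <= I)%E by apply: integral_ge0 => x _; rewrite lee_fin powR_ge0.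
(* Absorbing a term into the left-hand side is done in the reals, so the infinite case is settled
   first. *)
have [Ioo|Ifin] := eqVneq I +oo%E.
  by rewrite Ioo gt0_muley ?leey// lte_fin mulr_gt0.
have IE : I = (fine I)%:E by rewrite fineK// ge0_fin_numE// lt_neqAle Ifin leey.
have lower : ((lam * (N * m))%:E <= \int[mu]_(x in U) (`|f x| * Y x)%:E)%E.
  have -> : (\int[mu]_(x in U) (`|f x| * Y x)%:E =
             \sum_(k <- F) \int[mu]_(x in B k) (`|f x|)%:E)%E.
    under eq_integral do rewrite /Y mulr_sumr -sumEFin.
    rewrite ge0_integral_sum//; last first.
      move=> k; apply: measurable_funTS; apply/measurable_EFinP.
      by apply: measurable_funM => //; exact: measurable_indic.
    apply: eq_big_seq => k kF; under eq_integral do rewrite mulrC EFinM.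
    rewrite integral_indicM setIidr// => x Bx; by exists k.
  apply: (@le_trans _ _ (\sum_(k <- F) (lam%:E * mu Q))%E).
    rewrite muQ -EFinM sumEFin big_const_seq count_predT iter_addr_0.
    by rewrite lee_fin -mulr_natl mulrCA.
  by rewrite big_seq [leRHS]big_seq; apply: lee_sum => k /flam.
have upper : (\int[mu]_(x in U) (`|f x| * Y x)%:E <=
    (D * lam `^ (1 - p))%:E * I + (lam * tau * (C1 * (N * m)))%:E)%E.
  apply: (@le_trans _ _ (\int[mu]_(x in U)
      ((D * lam `^ (1 - p))%:E * (`|f x| `^ p)%:E + (lam * tau)%:E * (Y x `^ q)%:E))%E).
    apply: ge0_le_integral => //.
    - by move=> x _; rewrite lee_fin mulr_ge0.
    - apply: measurable_funTS; apply/measurable_EFinP; exact: measurable_funM.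
    - by apply: measurable_funTS; apply: emeasurable_funD; apply: measurable_funeM;
        apply/measurable_EFinP.
    by move=> x _; rewrite -!EFinM lee_fin; exact: young.
  rewrite ge0_integralD//; last 4 first.
  - by move=> x _; rewrite -!EFinM lee_fin !mulr_ge0 ?powR_ge0// ltW.
  - by apply: measurable_funTS; apply: measurable_funeM; apply/measurable_EFinP.
  - by move=> x _; rewrite -!EFinM lee_fin !mulr_ge0 ?powR_ge0// ltW.
  - by apply: measurable_funTS; apply: measurable_funeM; apply/measurable_EFinP.
  rewrite !ge0_integralZl_EFin ?mulr_ge0 ?powR_ge0 ?(ltW D0) ?(ltW lam0) ?(ltW tau0)//;
    try by [move=> x _; rewrite lee_fin powR_ge0
           |apply: measurable_funTS; apply/measurable_EFinP].
  rewrite leeD2l// [leRHS]EFinM lee_wpmul2l ?lee_fin ?mulr_ge0 ?(ltW lam0) ?(ltW tau0)//.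
  apply: le_trans (integral_powR_overlap_sum eps0 QB uF Fn p1 q1 pq epsA).
  apply: ge0_subset_integral => //; first exact/measurable_EFinP.
  by move=> x _; rewrite lee_fin powR_ge0.
have := le_trans lower upper; rewrite IE -EFinM -EFinD lee_fin => key.
apply: (@le_trans _ _ ((lam `^ p)%:E * (N * m)%:E)%E).
  by rewrite lee_wpmul2l// lee_fin powR_ge0.
rewrite -!EFinM lee_fin.
have tC : lam * tau * (C1 * (N * m)) = lam * (N * m) / 2.
  by rewrite /tau; field; rewrite gt_eqF.
have half : lam * (N * m) <= 2 * D * lam `^ (1 - p) * fine I.
  by move: key; rewrite tC; lra.
(* Multiplication by [lam ^ (p - 1)] cancels the factor [lam ^ (1 - p)]. *)
have := ler_wpM2l (powR_ge0 lam (p - 1)) half.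
have -> : lam `^ (p - 1) * (lam * (N * m)) = lam `^ p * (N * m).
  by rewrite mulrA [_ * lam]mulrC mulr_powRB1// ltW.
have -> : lam `^ (p - 1) * (2 * D * lam `^ (1 - p) * fine I) = 2 * D * fine I.
  have : lam `^ (p - 1) * lam `^ (1 - p) = 1.
    by rewrite -powRD ?(gt_eqF lam0) ?implybT// -[1 - p]opprB subrr powRr0.
  by move=> ll; rewrite -[RHS]mulr1 -[X in _ = _ * X]ll; ring.
by [].
Qed.

End weak_type_one_configuration.

Section lower_bound_one_configuration.
Context d (T : measurableType d) (R : realType) (mu : probability T R).
Variables (eps : R) (n : nat) (Q : set T) (B : nat -> set T).
Hypothesis QB : overlapping mu eps n Q B.

Lemma overlapping_setI k : (k < n)%N -> mu (Q `&` B k) = (eps%:E * mu Q)%E.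
Proof.
move=> kn; have := @ovl_indep _ _ _ _ _ _ _ _ QB [:: k] isT.
rewrite expr1 => <-; first by congr (mu _); congr (_ `&` _); apply/seteqP;
  split => [x Bx j|x]; [rewrite inE => /eqP ->|apply; rewrite inE].
by move=> j; rewrite inE => /eqP ->.
Qed.

(** The parts of the [B k] outside [Q] are disjoint, each of measure [(1 - eps) * mu Q]. *)
Lemma overlapping_bigcup_ge :
  (((1 - eps) * n%:R)%:E * mu Q <= mu (\bigcup_(k in [set k | (k < n)%N]) B k))%E.
Proof.
have mQ := ovl_mcore QB; have mB k := ovl_msets QB k.
have muQ : mu Q = (fine (mu Q))%:E by rewrite fineK ?fin_num_measure.
apply: (@le_trans _ _ (mu (\bigcup_(k in [set k | (k < n)%N]) (B k `\` Q)))); last first.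
  apply: le_measure; rewrite ?inE; last by apply: subset_bigcup => k _ x [].
    by apply: bigcup_measurable => k _; exact: measurableD.
  exact: bigcup_measurable.
rewrite measure_fin_bigcup//; last 2 first.
- move=> k l /= kn ln [x [[xk nQ] [xl _]]].
  have [//|kl] := eqVneq k l; exfalso.
  by apply: nQ; apply: (ovl_setI QB kn ln kl).
- by move=> k _; exact: measurableD.
rewrite -fsbig_ord/= (eq_bigr (fun=> ((1 - eps)%:E * mu Q)%E)) => [|k _].
  rewrite muQ -!EFinM sumEFin big_const_ord iter_addr_0 lee_fin.
  by rewrite -[leRHS]mulr_natl mulrA [n%:R * _]mulrC.
have kn := ltn_ord k.
rewrite measureD//; last by rewrite -ge0_fin_numE// fin_num_measure.
rewrite setIC [X in (_ - X)%E](overlapping_setI kn).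
by rewrite [X in (X - _)%E](ovl_mu_sets QB kn) muQ -!EFinM -EFinB mulrBl mul1r.
Qed.

End lower_bound_one_configuration.

(** * The maximal operator *)

Section maximal_operator_of_configurations.
Variables (R : realType) (mu : probability (torus R) R).
Local Notation torus := (torus R).
Implicit Types (f : torus -> R) (Bs : set (set torus)).

Definition average f (B : set torus) : \bar R :=
  ((fine (mu B))^-1%:E * \int[mu]_(y in B) (`|f y|)%:E)%E.

Lemma maximal_gtP Bs f x (lam : R) : 0 <= lam ->
  (lam%:E < maximal mu Bs f x)%E <->
  exists2 B, Bs B /\ B x & (lam%:E < average f B)%E.
Proof.
move=> lam0; split=> [/ereal_sup_gt[_ [->|[B BsB <-]] lt]|[B BsB lt]].
- by move: lt; rewrite lte_fin ltNge lam0.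
- by exists B.
- by apply: (lt_le_trans lt); apply: ereal_sup_ubound; right; exists B.
Qed.

Lemma Lfun_measurable p f : f \in Lfun mu p -> measurable_fun setT f.
Proof. by rewrite inE => /andP[]; rewrite inE. Qed.

Lemma overlapping_superlevel (eps : R) n Q B f (lam : R) :
  overlapping mu eps n Q B ->
  exists F : seq nat, [/\ uniq F, {in F, forall k, (k < n)%N},
    {in F, forall k, (lam%:E * mu Q <= \int[mu]_(x in B k) (`|f x|)%:E)%E} &
    [set x | exists2 B', [set B k | k in [set k | (k < n)%N]] B' /\ B' x &
       (lam%:E < average f B')%E] = \bigcup_(k in [set k | k \in F]) B k].
Proof.
move=> QB; pose F := [seq k <- iota 0 n | `[< (lam%:E < average f (B k))%E >]].
have Fn : {in F, forall k, (k < n)%N}.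
  by move=> k; rewrite mem_filter mem_iota => /andP[].
have Flam : {in F, forall k, (lam%:E < average f (B k))%E}.
  by move=> k; rewrite mem_filter => /andP[/asboolP].
exists F; split => //.
- by rewrite filter_uniq// iota_uniq.
- move=> k kF; have := Flam k kF; rewrite /average (ovl_mu_sets QB (Fn k kF)).
  have mQ := ovl_mcore QB.
  have muQ : mu Q = (fine (mu Q))%:E by rewrite fineK ?fin_num_measure.
  have m0 : 0 < fine (mu Q) by rewrite -lte_fin -muQ; exact: (ovl_core_gt0 QB).
  by rewrite lte_pdivlMl// -muQ muleC => /ltW.
apply/seteqP; split => [x [_ [[k /= kn <-] Bx] lt]|x [k /= kF Bx]].
  by exists k => //=; rewrite mem_filter mem_iota add0n kn !andbT; apply/asboolP.
by exists (B k); [split => //; exists k => //=; exact: Fn|exact: Flam].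
Qed.

Section family.
Variables (I : Type) (J : set I) (eps : I -> R) (d : I -> nat).
Variable S : I -> set (set torus).
Hypotheses (mu_haar : is_haar mu) (cJ : countable J).
Hypothesis Sconf : disjoint_configurations J eps d S.

Let M := maximal mu (\bigcup_(j in J) S j).

Lemma superlevel_partition f (lam : R) : 0 <= lam ->
  exists U : nat -> set torus,
    [/\ trivIset setT U, [set x | (lam%:E < M f x)%E] = \bigcup_n U n &
        forall n, U n = set0 \/ exists2 j, J j &
          U n = [set x | exists2 B, S j B /\ B x & (lam%:E < average f B)%E]].
Proof.
move=> lam0; have [g ginj] := elimT (countable_injP _) cJ.
pose V j := [set x | exists2 B, S j B /\ B x & (lam%:E < average f B)%E].
exists (fun n => \bigcup_(j in [set j | J j /\ g j = n]) V j); split.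
- move=> n n' _ _ [x [[j [Jj <-] [B [SB Bx] _]] [j' [Jj' <-] [B' [SB' Bx'] _]]]].
  congr g; apply: (Sconf.2 j j' Jj Jj'); exists x.
  by split; [exists B|exists B'].
- apply/seteqP; split => x.
    move=> /(maximal_gtP _ _ _ lam0)[B [[j Jj SB] Bx] lt].
    by exists (g j) => //; exists j => //; exists B.
  move=> [n _ [j [Jj _] [B [SB Bx] lt]]]; apply/(maximal_gtP _ _ _ lam0).
  by exists B => //; split => //; exists j.
- move=> n; have [[j [Jj gj]]|nj] := pselect (exists j, J j /\ g j = n); [right|left].
    exists j => //; apply/seteqP; split => [x [j' [Jj' gj'] xV]|x xV]; last by exists j.
    suff -> : j = j' by [].
    by apply: ginj; rewrite ?inE// gj gj'.
  by rewrite -subset0 => x [j jn _]; apply: nj; exists j.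
Qed.

Lemma config_overlapping j : J j -> exists Q B, overlapping mu (eps j) (d j) Q B /\
  S j = [set B k | k in [set k | (k < d j)%N]].
Proof. by move=> /Sconf.1[e _]; exact: configuration_overlapping. Qed.

Lemma measurable_superlevel_part f (lam : R) (U : set torus) :
  (U = set0 \/ exists2 j, J j &
     U = [set x | exists2 B, S j B /\ B x & (lam%:E < average f B)%E]) ->
  measurable U.
Proof.
case=> [->//|[j Jj ->]]; have [Q [B [QB ->]]] := config_overlapping Jj.
have [F [_ _ _ ->]] := overlapping_superlevel f lam QB.
by apply: bigcup_measurable => k _; exact: (ovl_msets QB k).
Qed.

Lemma weak_type_of_bound (p A : R) : 1 < p ->
  (forall j, J j -> eps j * (d j)%:R `^ p^-1 <= A) ->
  exists2 K : R, 0 <= K & weak_type_bound mu M p%:E K%:E.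
Proof.
move=> p1 epsA; have p0 : 0 < p by apply: lt_trans p1.
have [C C0 HC] := overlapping_weak_type mu A p1.
exists (C `^ p^-1); first exact: powR_ge0.
move=> f fp lam lam0; have mf := Lfun_measurable fp.
have mfp : measurable_fun setT (fun x => (`|f x| `^ p)%:E).
  apply/measurable_EFinP; apply: (measurableT_comp (measurable_powR p)).
  exact: measurableT_comp.
have [U [tU -> HU]] := superlevel_partition f (ltW lam0).
have mU n : measurable (U n) := measurable_superlevel_part (HU n).
have key n : ((lam `^ p)%:E * mu (U n) <= C%:E * \int[mu]_(x in U n) (`|f x| `^ p)%:E)%E.
  case: (HU n) => [->|[j Jj ->]].
    by rewrite measure0 integral_set0 !mule0.
  have [Q [B [QB ->]]] := config_overlapping Jj.
  have [F [uF Fn Flam ->]] := overlapping_superlevel f lam QB.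
  have [/andP[eps0 _] _ _] := Sconf.1 j Jj.
  exact: (HC _ _ _ _ _ _ _ eps0 (epsA j Jj) QB).
have mUU : measurable (\bigcup_n U n) by exact: bigcupT_measurable.
have total : ((lam `^ p)%:E * mu (\bigcup_n U n) <=
    C%:E * \int[mu]_x (`|f x| `^ p)%:E)%E.
  rewrite measure_semi_bigcup// -nneseriesZl//.
  apply: (@le_trans _ _ (C%:E * \int[mu]_(x in \bigcup_n U n) (`|f x| `^ p)%:E)%E).
    rewrite ge0_integral_bigcup//; last exact: measurable_funTS.
    rewrite -nneseriesZl; last by move=> n _; apply: integral_ge0 => x _; rewrite lee_fin powR_ge0.
    apply: lee_nneseries => [n _ _|n _]; last exact: key.
    by rewrite mule_ge0// lee_fin powR_ge0.
  rewrite lee_wpmul2l// ?lee_fin ?(ltW C0)//; exact: ge0_subset_integral.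
have pV0 : 0 <= p^-1 by rewrite invr_ge0 ltW.
have I0 : (0 <= \int[mu]_x (`|f x| `^ p)%:E)%E.
  by apply: integral_ge0 => x _; rewrite lee_fin powR_ge0.
have := @gt0_ler_poweR R p^-1 pV0 _ _ _ _ total.
rewrite !poweRM ?lee_fin ?powR_ge0 ?(ltW C0)// !poweR_EFin -powRrM mulfV ?gt_eqF//.
rewrite powRr1 ?(ltW lam0)// unlock /=; apply.
- by rewrite in_itv/= mule_ge0 ?leey// lee_fin powR_ge0.
- by rewrite in_itv/= mule_ge0 ?leey// lee_fin ltW.
Qed.

(** The indicator of [Q] is tested at level [eps / 2], strictly below its averages [eps]. As
    [1 - eps >= 1/2], the superlevel set has measure at least [d * m / 2], whence
    [(eps / 2) * (d / 2) ^ (1/p) <= K]. *)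
Lemma bound_of_weak_type (p K : R) : 1 <= p -> weak_type_bound mu M p%:E K%:E ->
  forall j, J j -> eps j * (d j)%:R `^ p^-1 <= 2 * 2 `^ p^-1 * K.
Proof.
move=> p1 HK j Jj; have p0 : 0 < p by apply: lt_le_trans p1.
have [/andP[eps0 eps2] _ _] := Sconf.1 j Jj.
have [Q [B [QB SB]]] := config_overlapping Jj.
have mQ := ovl_mcore QB; have mB k := ovl_msets QB k.
pose m : R := fine (mu Q).
have muQ : mu Q = m%:E by rewrite fineK ?fin_num_measure.
have m0 : 0 < m by rewrite -lte_fin -muQ; exact: (ovl_core_gt0 QB).
pose f : torus -> R := \1_Q; have mf : measurable_fun setT f by exact: measurable_indic.
have intfp : (\int[mu]_x (`|f x| `^ p)%:E = m%:E)%E.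
  rewrite -muQ -[Q in RHS]setIT -integral_indic//; apply: eq_integral => x _.
  by rewrite /f indicE; case: (_ \in _); rewrite ?normr1 ?powR1// normr0 powR0// gt_eqF.
have normf : ('N[mu]_(p%:E)[EFin \o f] = (m `^ p^-1)%:E)%E.
  by rewrite unlock /= -poweR_EFin -intfp.
have fp : f \in Lfun mu p%:E.
  by rewrite inE; apply/andP; rewrite !inE/=; split => //; rewrite /finite_norm normf ltry.
have e20 : 0 < eps j / 2 by rewrite divr_gt0.
have := HK f fp _ e20; rewrite normf.
have [U [_ ME HU]] := superlevel_partition f (ltW e20).
have mM : measurable [set x | ((eps j / 2)%:E < M f x)%E].
  by rewrite ME; apply: bigcupT_measurable => n; exact: measurable_superlevel_part (HU n).
have sub : \bigcup_(k in [set k | (k < d j)%N]) B k `<=`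
    [set x | ((eps j / 2)%:E < M f x)%E].
  move=> x [k /= kd Bx]; apply/(maximal_gtP _ _ _ (ltW e20)); exists (B k).
    by split => //; exists j => //; rewrite SB; exists k.
  rewrite /average (ovl_mu_sets QB kd).
  have -> : (\int[mu]_(y in B k) (`|f y|)%:E = (eps j * m)%:E)%E.
    rewrite EFinM -muQ -(overlapping_setI QB kd) -integral_indic//.
    by apply: eq_integral => y _; rewrite /f ger0_norm// indicE ler0n.
  rewrite lte_pdivlMl// -EFinM lte_fin -/m.
  by have em : 0 < eps j * m := mulr_gt0 eps0 m0; lra.
have lo : (((d j)%:R * m / 2)%:E <= mu [set x | ((eps j / 2)%:E < M f x)%E])%E.
  apply: (@le_trans _ _ (mu (\bigcup_(k in [set k | (k < d j)%N]) B k))); last first.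
    by apply: le_measure => //; rewrite inE//; apply: bigcup_measurable => k _.
  apply: le_trans (overlapping_bigcup_ge QB); rewrite muQ -EFinM lee_fin.
  have dm0 : 0 <= (d j)%:R * m by rewrite mulr_ge0 ?ler0n ?(ltW m0).
  by rewrite -mulrA; nra.
move=> HK'; have dm0 : 0 <= (d j)%:R * m / 2 by rewrite !mulr_ge0 ?ler0n ?(ltW m0).
have pw : ((((d j)%:R * m / 2) `^ p^-1)%:E <=
    mu [set x | ((eps j / 2)%:E < M f x)%E] `^ p^-1)%E.
  rewrite -poweR_EFin; apply: gt0_ler_poweR => //; rewrite ?invr_ge0 ?(ltW p0)//.
    by rewrite in_itv/= lee_fin dm0 leey.
  by rewrite in_itv/= measure_ge0 leey.
have e20' : (0 <= (eps j / 2)%:E)%E by rewrite lee_fin ltW.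
have := le_trans (lee_wpmul2l e20' pw) HK'; rewrite -!EFinM lee_fin.
have -> : (d j)%:R * m / 2 = (d j)%:R * 2^-1 * m by rewrite mulrAC.
rewrite !powRM ?mulr_ge0 ?ler0n ?(ltW m0)// !mulrA ler_pM2r ?powR_gt0//.
have t0 : 0 < 2 `^ p^-1 :> R by rewrite powR_gt0.
have -> : 2^-1 `^ p^-1 = (2 `^ p^-1)^-1 :> R.
  by rewrite -powR_inv1// -powRrM mulN1r powRN.
rewrite ler_pdivrMr// => h; lra.
Qed.

End family.

Lemma weak_type_infty Bs : (forall B, Bs B -> measurable B) ->
  weak_type_bound mu (maximal mu Bs) +oo%E 1%E.
Proof.
move=> mBs f fp; have mf := Lfun_measurable fp; rewrite mul1e.
set b := ('N[mu]_+oo[EFin \o f])%E; have b0 : (0 <= b)%E by exact: Lnorm_ge0.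
have fb : \forall x \ae mu, (`|f x|%:E <= b)%E.
  rewrite /b unlock /= probability_setT lte01; exact: (ess_sup_ge mu (abse \o (EFin \o f))).
rewrite unlock /= probability_setT lte01.
apply/ess_supP; apply: aeW => x /=.
have M0 : (0 <= maximal mu Bs f x)%E by apply: ereal_sup_ubound; left.
rewrite gee0_abs//; apply: ge_ereal_sup => _ [->//|[B [/mBs mB _] <-]].
have muB : mu B = (fine (mu B))%:E by rewrite fineK ?fin_num_measure.
(* The inverse of 0 is 0, so null sets contribute the average 0. *)
have [B0|B0] := eqVneq (fine (mu B)) 0; first by rewrite B0 invr0 mul0e.
have B_gt0 : 0 < fine (mu B) by rewrite lt_neqAle eq_sym B0 fine_ge0.
rewrite lee_pdivrMl// -muB muleC -integral_cst//.
apply: ae_ge0_le_integral => //.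
- by apply: measurable_funTS; apply/measurable_EFinP; exact: measurableT_comp.
- by apply: filterS fb => y.
Qed.

End maximal_operator_of_configurations.

(** * Growth of the sequences and boundedness *)

Section growth.
Variable R : realType.
Implicit Types (p x A C : R) (j F : nat).

(** Here [F >= 1], so [x < F + 1 <= 2 * F]. *)
Lemma floor_nat_bounds F x : 1 <= x -> F%:Z = Num.floor x ->
  x / 2 <= F%:R <= x.
Proof.
move=> x1 Fx; have /andP[] := real_floor_itv (num_real x).
rewrite -Fx intrD -[F%:~R]/(F%:R : R) -[1%:~R]/(1 : R) => lo hi; rewrite lo andbT.
have : 1 <= F%:R :> R by rewrite ler1n -(ltr_nat R); lra.
lra.
Qed.

Lemma scaled_root_le p C j F : 1 <= p -> 0 <= C -> (0 < j)%N ->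
  F%:R <= C * j%:R `^ p -> 1 / (j%:R + 1) * F%:R `^ p^-1 <= C `^ p^-1.
Proof.
move=> p1 C0 j0 FC; have p0 : 0 < p by apply: lt_le_trans p1.
have jR : 0 < j%:R :> R by rewrite ltr0n.
have rF : F%:R `^ p^-1 <= C `^ p^-1 * j%:R.
  have -> : C `^ p^-1 * j%:R = (C * j%:R `^ p) `^ p^-1.
    by rewrite powRM ?powR_ge0// -powRrM mulfV ?gt_eqF// powRr1// ltW.
  apply: ge0_ler_powR; rewrite ?nnegrE ?ler0n ?invr_ge0 ?(ltW p0)//.
  by rewrite mulr_ge0 ?powR_ge0.
have Cp : 0 <= C `^ p^-1 := powR_ge0 _ _.
by rewrite mul1r ler_pdivrMl ?addr_gt0//; lra.
Qed.

(** One factor 2 pays for the floor and the other for [j / (j + 1) >= 1/2]; the root is then at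
    least [2 * (A + 1) * j]. *)
Lemma scaled_root_gt p A j F x : 1 <= p -> 0 <= A -> (0 < j)%N ->
  F%:Z = Num.floor x -> 2 * (2 * (A + 1)) `^ p * j%:R `^ p <= x ->
  A < 1 / (j%:R + 1) * F%:R `^ p^-1.
Proof.
move=> p1 A0 j0 Fx xA; have p0 : 0 < p by apply: lt_le_trans p1.
have j1 : 1 <= j%:R :> R by rewrite ler1n.
have pow1 (a : R) : 1 <= a -> 1 <= a `^ p.
  by move=> a1; rewrite -[leLHS](powRr0 a) ler_powR// ltW.
have x1 : 1 <= x.
  apply: le_trans xA; have := pow1 _ j1; have : 1 <= (2 * (A + 1)) `^ p by apply: pow1; lra.
  nra.
have /andP[xF _] := floor_nat_bounds x1 Fx.
have FA : (2 * (A + 1) * j%:R) `^ p <= F%:R.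
  by rewrite powRM; [lra|lra|lra].
have rF : 2 * (A + 1) * j%:R <= F%:R `^ p^-1.
  have -> : 2 * (A + 1) * j%:R = ((2 * (A + 1) * j%:R) `^ p) `^ p^-1.
    by rewrite -powRrM mulfV ?gt_eqF// powRr1//; nra.
  by apply: ge0_ler_powR; rewrite ?nnegrE ?powR_ge0 ?ler0n ?invr_ge0 ?(ltW p0).
by rewrite mul1r ltr_pdivlMl ?addr_gt0//; [nra|lra].
Qed.

(** Apply [ln t < t] to [t = y ^ s]. *)
Lemma ln_le_powR (s y : R) : 0 < s -> 0 < y -> ln y <= s^-1 * y `^ s.
Proof.
move=> s0 y0; rewrite ler_pdivlMl// -ln_powR.
have ys : 0 < y `^ s by rewrite powR_gt0.
exact: ltW (ln_sublinear ys).
Qed.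

Definition bounded_root_sequence (d : nat -> nat) p : Prop :=
  exists A, forall j, (0 < j)%N -> 1 / (j%:R + 1) * (d j)%:R `^ p^-1 <= A.

Lemma exists_nat_ge (y : R) : exists2 j, (0 < j)%N & y <= j%:R.
Proof. by exists (Num.truncn y).+1 => //; rewrite ltW// truncnS_gt. Qed.

Lemma bounded_root_floor_powR (p0 p : R) (d : nat -> nat) : 1 < p0 -> 1 <= p ->
  (forall j, (0 < j)%N -> (d j)%:Z = Num.floor (j%:R `^ p0 : R)) ->
  bounded_root_sequence d p <-> p0 <= p.
Proof.
move=> p01 p1 dE; split=> [[A HA]|p0p].
  rewrite leNgt; apply/negP => pp0; have pp0' : 0 < p0 - p by rewrite subr_gt0.
  have A0 : 0 <= A.
    by apply: le_trans (HA 1 isT); rewrite mulr_ge0 ?powR_ge0 ?divr_ge0 ?addr_ge0.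
  pose L := 2 * (2 * (A + 1)) `^ p.
  (* For such [j] the surplus power [j ^ (p0 - p)] is at least [L]. *)
  have [j j0 Lj] := exists_nat_ge (L `^ (p0 - p)^-1).
  suff xA : L * j%:R `^ p <= j%:R `^ p0.
    by have := scaled_root_gt p1 A0 j0 (dE j j0) xA; rewrite ltNge HA.
  have -> : j%:R `^ p0 = j%:R `^ (p0 - p) * j%:R `^ p :> R.
    by rewrite -powRD ?subrK// pnatr_eq0 -lt0n j0 implybT.
  rewrite ler_wpM2r ?powR_ge0// -/L.
  have L0 : 0 <= L by rewrite mulr_ge0 ?powR_ge0.
  have -> : L = (L `^ (p0 - p)^-1) `^ (p0 - p).
    by rewrite -powRrM mulVf ?gt_eqF// powRr1.
  by apply: ge0_ler_powR; rewrite ?nnegrE ?powR_ge0 ?ler0n// ltW.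
exists (1 `^ p^-1) => j j0; apply: scaled_root_le => //.
have j1 : 1 <= j%:R :> R by rewrite ler1n.
rewrite mul1r; apply: (@le_trans _ _ (j%:R `^ p0)); last by rewrite ler_powR.
have x1 : 1 <= j%:R `^ p0 :> R.
  by rewrite -[leLHS](powRr0 j%:R) ler_powR// ltW// (lt_trans _ p01).
by have /andP[] := floor_nat_bounds x1 (dE j j0).
Qed.

Lemma bounded_root_floor_ln_powR (p0 p : R) (d : nat -> nat) : 1 < p0 -> 1 <= p ->
  (forall j, (0 < j)%N -> (d j)%:Z = Num.floor (ln (j%:R + 2) * j%:R `^ p0 : R)) ->
  bounded_root_sequence d p <-> p0 < p.
Proof.
move=> p01 p1 dE; split=> [[A HA]|p0p].
  rewrite ltNge; apply/negP => pp0.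
  have A0 : 0 <= A.
    by apply: le_trans (HA 1 isT); rewrite mulr_ge0 ?powR_ge0 ?divr_ge0 ?addr_ge0.
  pose L := 2 * (2 * (A + 1)) `^ p.
  (* Now the logarithm alone is at least [L], which also excludes the endpoint [p = p0]. *)
  have [j j0 Lj] := exists_nat_ge (expR L).
  suff xA : L * j%:R `^ p <= ln (j%:R + 2) * j%:R `^ p0.
    by have := scaled_root_gt p1 A0 j0 (dE j j0) xA; rewrite ltNge HA.
  have j1 : 1 <= j%:R :> R by rewrite ler1n.
  have L0 : 0 <= L by rewrite mulr_ge0 ?powR_ge0.
  apply: ler_pM => //; rewrite ?powR_ge0// ?ler_powR//.
  by rewrite -ler_expR lnK ?posrE ?addr_gt0 ?ltr0n//; lra.
have s0 : 0 < p - p0 by rewrite subr_gt0.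
(* The constant comes from [ln (j + 2) <= s^-1 * (j + 2) ^ s] and [j + 2 <= 3 * j]. *)
set s := p - p0 in s0; exists ((s^-1 * 3 `^ s) `^ p^-1) => j j0.
have j1 : 1 <= j%:R :> R by rewrite ler1n.
have c0 : 0 <= s^-1 * 3 `^ s by rewrite mulr_ge0 ?powR_ge0 ?invr_ge0 ?(ltW s0).
apply: scaled_root_le => //; apply: (@le_trans _ _ (ln (j%:R + 2) * j%:R `^ p0)).
  have := dE j j0; have /andP[lo _] := real_floor_itv (num_real (ln (j%:R + 2) * j%:R `^ p0 : R)).
  by move=> E; move: lo; rewrite -E.
have -> : j%:R `^ p = j%:R `^ s * j%:R `^ p0 :> R.
  by rewrite -powRD ?subrK// pnatr_eq0 -lt0n j0 implybT.
rewrite mulrA ler_wpM2r ?powR_ge0// -mulrA -powRM ?ler0n//.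
apply: (le_trans (ln_le_powR s0 _)); first by lra.
rewrite ler_wpM2l ?invr_ge0 ?(ltW s0)//.
by apply: ge0_ler_powR; rewrite ?nnegrE ?(ltW s0)//; lra.
Qed.

End growth.

Section boundedness_criteria.
Variables (R : realType) (mu : probability (torus R) R).

Lemma weak_norm_lty M (p : \bar R) : (weak_norm mu M p < +oo)%E <->
  exists2 K : R, 0 <= K & weak_type_bound mu M p K%:E.
Proof.
split=> [/ereal_inf_lt[[K| |] [K0 HK] Koo]//|[K K0 HK]].
  by exists K.
by apply: (@le_lt_trans _ _ K%:E); [apply: ereal_inf_lbound|rewrite ltry].
Qed.

Section family.
Variables (I : Type) (J : set I) (eps : I -> R) (d : I -> nat).
Variable S : I -> set (set (torus R)).
Hypotheses (mu_haar : is_haar mu) (cJ : countable J).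
Hypothesis Sconf : disjoint_configurations J eps d S.
Let M := maximal mu (\bigcup_(j in J) S j).

(** This direction includes [p = 1], which is how that exponent is excluded in the two examples. *)
Lemma configurations_bounded_le (p : R) : 1 <= p -> weakly_bounded mu M p%:E ->
  exists A, forall j, J j -> eps j * (d j)%:R `^ p^-1 <= A.
Proof.
move=> p1 /weak_norm_lty[K _ HK].
by eexists; exact: (bound_of_weak_type mu_haar cJ Sconf p1 HK).
Qed.

Lemma configurations_bounded (p : R) : 1 < p -> weakly_bounded mu M p%:E <->
  exists A, forall j, J j -> eps j * (d j)%:R `^ p^-1 <= A.
Proof.
move=> p1; split=> [|[A HA]]; first exact: (configurations_bounded_le (ltW p1)).
apply/weak_norm_lty.
by have [K K0 HK] := weak_type_of_bound mu_haar cJ Sconf p1 HA; exists K.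
Qed.

Lemma configurations_bounded_infty : weakly_bounded mu M +oo%E.
Proof.
apply/weak_norm_lty; exists 1 => //; apply: weak_type_infty => B [j Jj SB].
have [Q [B' [QB SE]]] := config_overlapping mu_haar Sconf Jj.
by move: SB; rewrite SE => -[k _ <-]; exact: (ovl_msets QB k).
Qed.

End family.

Lemma harmonic_configurations_range (eps : nat -> R) (d : nat -> nat)
    (S : nat -> set (set (torus R))) (P : R -> Prop) :
  is_haar mu -> disjoint_configurations pos_nat eps d S ->
  (forall j, pos_nat j -> eps j = 1 / (j%:R + 1)) ->
  (forall p, P p -> 1 < p) ->
  (forall p, 1 <= p -> bounded_root_sequence d p <-> P p) ->
  forall p : \bar R,
    (1 <= p)%E /\ weakly_bounded mu (maximal mu (\bigcup_(j in pos_nat) S j)) p <->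
    match p with r%:E => P r | +oo%E => True | -oo%E => False end.
Proof.
move=> mu_haar Sconf epsE P1 boundP.
have cJ : countable pos_nat by exact: countableP.
have epsB p : (exists A, forall j, pos_nat j -> eps j * (d j)%:R `^ p^-1 <= A) <->
    bounded_root_sequence d p.
  by split=> -[A HA]; exists A => j j0; [rewrite -epsE//|rewrite epsE//]; exact: HA.
case=> [p| |]; last by split=> // -[].
- split=> [[p1 /(configurations_bounded_le mu_haar cJ Sconf p1)/epsB]|Pp].
    by move/boundP; apply.
  have p1 := P1 _ Pp; split; first by rewrite lee_fin ltW.
  by apply/(configurations_bounded mu_haar cJ Sconf p1)/epsB/boundP => //; exact: ltW.
- split=> // _; split; first by rewrite leey.
  exact: configurations_bounded_infty mu_haar Sconf.
Qed.

End boundedness_criteria.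


Theorem corollary1p3 (R : realType) (mu : probability (torus R) R)
    (mu_haar : is_haar mu) :
  [/\ forall (I : Type) (J : set I) (eps : I -> R) (d : I -> nat)
        (S : I -> set (set (torus R))),
        countable J -> disjoint_configurations J eps d S ->
        forall p : R, 1 < p ->
          (weak_norm mu (maximal mu (\bigcup_(j in J) S j)) p%:E < +oo)%E <->
          (ereal_sup [set (eps j * (d j)%:R `^ p^-1)%:E | j in J] < +oo)%E,
      forall (p0 : R) (eps : nat -> R) (d : nat -> nat)
        (S : nat -> set (set (torus R))),
        1 < p0 ->
        (forall j, pos_nat j -> eps j = 1 / (j%:R + 1)) ->
        (forall j, pos_nat j -> (d j)%:Z = Num.floor (j%:R `^ p0 : R)) ->
        disjoint_configurations pos_nat eps d S ->
        [set p : \bar R | (1 <= p)%E /\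
           weakly_bounded mu (maximal mu (\bigcup_(j in pos_nat) S j)) p] =
        [set p : \bar R | (p0%:E <= p)%E]
    & forall (p0 : R) (eps : nat -> R) (d : nat -> nat)
        (S : nat -> set (set (torus R))),
        1 < p0 ->
        (forall j, pos_nat j -> eps j = 1 / (j%:R + 1)) ->
        (forall j, pos_nat j ->
           (d j)%:Z = Num.floor (ln (j%:R + 2) * j%:R `^ p0 : R)) ->
        disjoint_configurations pos_nat eps d S ->
        [set p : \bar R | (1 <= p)%E /\
           weakly_bounded mu (maximal mu (\bigcup_(j in pos_nat) S j)) p] =
        [set p : \bar R | (p0%:E < p)%E] ].
Proof.
split.
- move=> I J eps d S cJ Sconf p p1; 
  apply: (iff_trans (configurations_bounded mu_haar cJ Sconf p1)).
  split=> [[A HA]|supA].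
    apply: (@le_lt_trans _ _ A%:E); last by rewrite ltry.
    by apply: ge_ereal_sup => _ [j Jj <-]; rewrite lee_fin HA.
  (* For empty [J] the supremum is [-oo] and [fine] returns a default; any [j] in [J] rules this
     out. *)
  exists (fine (ereal_sup [set (eps j * (d j)%:R `^ p^-1)%:E | j in J])) => j Jj.
  have jsup : ((eps j * (d j)%:R `^ p^-1)%:E <=
      ereal_sup [set (eps j * (d j)%:R `^ p^-1)%:E | j in J])%E.
    by apply: ereal_sup_ubound; exists j.
  by case: (ereal_sup _) supA jsup => [r||]//= _; rewrite lee_fin.
- move=> p0 eps d S p0_gt1 epsE dE Sconf.
  have range := harmonic_configurations_range mu_haar Sconf epsE
    (P := fun p => p0 <= p) (fun p => lt_le_trans p0_gt1)
    (fun p p1 => bounded_root_floor_powR p0_gt1 p1 dE).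
  apply/seteqP; split => p; rewrite /mkset => p0p.
    by move/range: p0p; case: p => [p| |]//; rewrite ?leey// lee_fin.
  by apply/range; case: p p0p.
- move=> p0 eps d S p0_gt1 epsE dE Sconf.
  have range := harmonic_configurations_range mu_haar Sconf epsE
    (P := fun p => p0 < p) (fun p => lt_trans p0_gt1)
    (fun p p1 => bounded_root_floor_ln_powR p0_gt1 p1 dE).
  apply/seteqP; split => p; rewrite /mkset => p0p.
    by move/range: p0p; case: p => [p| |]//; rewrite ?ltry// lte_fin.
  by apply/range; case: p p0p.
Qed.
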